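(* Let $\phi\in\mathcal{S}_2$ and $\tau=(\tau^1,\tau^2)\in\mathbb{T}^2$. Assume also that $\alpha$ and $M$ are positive numbers. The following assertions are equivalent: (i) $\tau$ is a B-point for $\phi$ and $$\frac{D_{-(\tau^1,\tau^2M)}\phi(\tau)}{-\phi(\tau)}\le\alpha;$$ (ii) there exists a sequence $\{\lambda_n\}\subset\mathbb{D}^2$ such that $\lambda_n\to\tau$, $\lim_n\frac{1-|\lambda^2_n|}{1-|\lambda^1_n|}=M$ and $$\lim_n\frac{1-|\phi(\lambda_n)|}{1-\|\lambda_n\|}\le\begin{cases}\alpha & \text{if } M\ge1,\\ \frac{\alpha}{M} & \text{if } M<1;\end{cases}$$ (iii) there exists $\omega\in\mathbb{T}$ such that $$\phi\big(E(\tau,R_1,R_2)\big)\subset E\big(\omega,\max\{\alpha R_1,\alpha R_2/M\}\big)\quad\text{for all } R_1,R_2>0.$$ If (iii) holds, $\omega$ will necessarily be equal to $\phi(\tau)$.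
   Context: $\mathbb{D}$ is the open unit disk, $\mathbb{T}=\partial\mathbb{D}$, $\mathbb{H}=\{z\in\mathbb{C}:\Re z>0\}$. $\mathcal{S}_2$ is the two-variable Schur class, i.e. the set of analytic functions on $\mathbb{D}^2$ that are bounded by $1$ in modulus. Superscripts $1,2$ on points are coordinate indices: $\lambda_n=(\lambda_n^1,\lambda_n^2)$. $\|(\lambda^1,\lambda^2)\|=\max\{|\lambda^1|,|\lambda^2|\}$. A point $\tau\in\partial\mathbb{D}^2$ is a B-point for $\phi\in\mathcal{S}_2$ if $\liminf_{\lambda\to\tau}\frac{1-|\phi(\lambda)|}{1-\|\lambda\|}<\infty$; then the nontangential limit of $\phi$ at $\tau$ exists and is denoted $\phi(\tau)$ (nontangential means along sets $S\subset\mathbb{D}^2$ with $\tau$ in their closure on which $\|\tau-\lambda\|\le c(1-\|\lambda\|)$ for some constant $c>0$). For a B-point $\tau\in\mathbb{T}^2$ and $\delta\in\tau^1\mathbb{H}\times\tau^2\mathbb{H}$, the directional derivative $D_{-\delta}\phi(\tau)=\lim_{t\to0+}\frac{\phi(\tau-t\delta)-\phi(\tau)}{t}$ exists. For $\omega\in\mathbb{T}$ and $R>0$, $E(\omega,R)=\{z\in\mathbb{D}:\frac{|z-\omega|^2}{1-|z|^2}<R\}$ (a horocycle), and for $\tau=(\tau^1,\tau^2)\in\mathbb{T}^2$ and $R_1,R_2>0$, $E(\tau,R_1,R_2)=E(\tau^1,R_1)\times E(\tau^2,R_2)$ (a weighted horosphere).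
   Formalization: The equivalence of (iii) with (i) and (ii) is asserted only when φ is not a unimodular constant: for such φ, (i) and (ii) hold but (iii) fails, since E(ω,R) lies in the open disk. (i)⇔(ii) and the final claim on ω are for all φ in S_2. *)

(* Defs.v *)
From HB Require Import structures.
From mathcomp Require Import all_boot all_order all_algebra.
From mathcomp Require Import all_classical all_reals all_analysis.
From mathcomp Require Export complex.

Set Implicit Arguments.
Unset Strict Implicit.
Unset Printing Implicit Defensive.

Import Order.TTheory GRing.Theory Num.Theory.
Import numFieldNormedType.Exports.

Local Open Scope classical_set_scope.
Local Open Scope ring_scope.
Local Open Scope complex_scope.

(* The regular module [R[i]^o] is what carries the topology and the structure
   of normed module over [R[i]]; hence [differentiable] below is
   complex (Frechet) differentiability. *)
Notation Cplx R := (R[i]^o).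
Notation Cplx2 R := (R[i]^o * R[i]^o)%type.

Section Bidisk.
Variable R : realType.
Implicit Types (phi : Cplx2 R -> Cplx R) (tau delta : Cplx2 R).

(* The library norm [`|z|] on [R[i]] is [R[i]]-valued; this is the same modulus,
   as an element of [R]. *)
Definition modulus (z : Cplx R) : R := complex.Re `|z|.

Definition maxmod (lambda : Cplx2 R) : R :=
  Num.max (modulus lambda.1) (modulus lambda.2).

Definition disk : set (Cplx R) := [set z | modulus z < 1].

Definition circle : set (Cplx R) := [set z | modulus z = 1].

Definition bidisk : set (Cplx2 R) := disk `*` disk.

Definition torus : set (Cplx2 R) := circle `*` circle.

(* The values of [phi] outside the bidisk are irrelevant here and everywhere
   below. *)
Definition schur2 phi :=
  forall lambda, bidisk lambda ->
    differentiable phi lambda /\ modulus (phi lambda) <= 1.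

(* Such functions belong to the Schur class; they map no nonempty set into a
   horocycle, since horocycles are subsets of the open disk. *)
Definition unimodular_constant phi :=
  exists2 c, circle c & forall lambda, bidisk lambda -> phi lambda = c.

Definition julia_quotient phi (lambda : Cplx2 R) : R :=
  (1 - modulus (phi lambda)) / (1 - maxmod lambda).

Definition B_point phi tau :=
  (limf_einf (fun lambda => (julia_quotient phi lambda)%:E)
             (within bidisk (nbhs tau)) < +oo)%E.

Definition nontangential_set tau (S : set (Cplx2 R)) :=
  [/\ S `<=` bidisk, closure S tau &
      exists2 c : R, 0 < c &
        forall lambda, S lambda -> maxmod (tau - lambda) <= c * (1 - maxmod lambda)].

(* [is_boundary_value phi tau w] reads "phi(tau) exists and equals w". *)
Definition is_boundary_value phi tau (w : Cplx R) :=
  forall S, nontangential_set tau S -> phi @ within S (nbhs tau) --> w.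

(* [w] stands for the boundary value phi(tau), and [d] for the derivative
   D_{-delta} phi(tau); [t] is real. *)
Definition is_directional_derivative phi tau (w : Cplx R) delta (d : Cplx R) :=
  ((phi (tau - t%:C *: delta) - w) / t%:C : Cplx R) @[t --> (0 : R)^'+] --> d.

Definition horocycle (omega : Cplx R) (r : R) : set (Cplx R) :=
  [set z | disk z /\ modulus (z - omega) ^+ 2 / (1 - modulus z ^+ 2) < r].

Definition horosphere tau (r1 r2 : R) : set (Cplx2 R) :=
  horocycle tau.1 r1 `*` horocycle tau.2 r2.

(* The order of [R[i]] is partial: [x <= a%:C] says that [x] is real and at most
   [a]. *)
Definition derivative_condition phi tau (alpha M : R) :=
  B_point phi tau /\
  exists w d : Cplx R,
    [/\ is_boundary_value phi tau w,
        is_directional_derivative phi tau w (tau.1, tau.2 * M%:C) d &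
        d / (- w) <= alpha%:C].

Definition sequence_condition phi tau (alpha M : R) :=
  exists lambda : nat -> Cplx2 R,
    [/\ forall n, bidisk (lambda n),
        lambda @ \oo --> tau,
        (1 - modulus (lambda n).2) / (1 - modulus (lambda n).1) @[n --> \oo] --> M &
        exists2 l : R, julia_quotient phi (lambda n) @[n --> \oo] --> l &
          l <= if 1 <= M then alpha else alpha / M].

Definition horosphere_condition phi tau (alpha M : R) (omega : Cplx R) :=
  circle omega /\
  forall r1 r2 : R, 0 < r1 -> 0 < r2 ->
    phi @` horosphere tau r1 r2
      `<=` horocycle omega (Num.max (alpha * r1) (alpha * r2 / M)).

End Bidisk.

(* Main.v *)
Require Import Defs.
From HB Require Import structures.
From mathcomp Require Import all_boot all_order all_algebra.
From mathcomp Require Import all_classical all_reals all_analysis.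
From mathcomp Require Import ring lra.

Set Implicit Arguments.
Unset Strict Implicit.
Unset Printing Implicit Defensive.

Import Order.TTheory GRing.Theory Num.Theory.
Import numFieldNormedType.Exports.

Local Open Scope classical_set_scope.
Local Open Scope ring_scope.
Local Open Scope complex_scope.

(** Write [R_i(mu) = |mu_i - tau_i|^2 / (1 - |mu_i|^2)].  Each of the three
conditions amounts to one inequality, valid on the whole bidisk for some
unimodular [w]:
  [|phi mu - w|^2 <= (1 - |phi mu|^2) max (alpha R_1(mu), alpha R_2(mu) / M)],
which is [julia_bound phi tau w alpha (alpha / M)].  Dividing it by
[1 - |phi mu|^2] gives the inclusion of horospheres; the division loses
something only when [|phi| = 1] somewhere, and then [phi] is a unimodular
constant.

From sequences to the inequality.  The Schwarz-Pick inequality on the bidisk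
([bidisk_schwarz_pick]) bounds [|1 - conj(phi lambda) phi mu|^2].  Let
[lambda] tend to [tau] in such a way that both ratios
[(1 - |phi lambda|) / (1 - |lambda_i|)] converge to limits [a_i]: what remains
is the inequality with constants [a_1] and [a_2] ([julia_limit]).  If the
ratios are only bounded, a finer ultrafilter makes everything converge
([julia_cluster]).

From the inequality to the derivative.  On the ray
[tau - t (tau_1, M tau_2)], both [R_1] and [R_2 / M] are [t / 2] to first order,
so the inequality with constant [a] forces [limsup q <= a] for
[q t = (1 - |phi|) / t].  Conversely Julia's lemma on the ray turns every
cluster value [b] of [q] into an admissible constant.  So any two cluster
values are each at most the other, [q] converges to some [b <= alpha], and the
inequality holds with [b] ([ray_quotient_cvg]).  It then says that the square of
the modulus of [(1 - conj w phi) / t] is at most [q b] up to a factor tending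
to one, while its real part is at least [q]; so it converges to [b], and
[- w b] is the directional derivative ([ray_derivative]).

The Schwarz lemma is derived from [goursat] without power series or residues.
If [g a = 1] and [|g| <= q < 1] on the frame of a rectangle around [a], then
[(w - p)^2 (g^n - 1)^3 / (w - a)] is complex differentiable in the whole
rectangle, even at [a] and at a point [p] near which [g] is merely bounded; so
its frame integral vanishes, although as [n] grows it tends to that of
[- (w - p)^2 / (w - a)], which is not zero.  This is
[frame_maximum_principle].  Rectangles exhaust the right half-plane in such a
way that [|w + 1| / |w - 1|] is nearly one on their frames, and the principle
applied to [G w (w + 1) / (w - 1)] yields [half_plane_schwarz], hence the
lemma for the disk by a Cayley transform. *)

(** * Modulus and convergence in the complex plane *)

Section Modulus.
Context {R : realType}.
Implicit Types z w : Cplx R.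

Lemma modulusE z : modulus z = Num.sqrt (complex.Re z ^+ 2 + complex.Im z ^+ 2).
Proof. by rewrite /modulus [`|z|]normc_def. Qed.

Lemma normE z : `|z| = (modulus z)%:C :> R[i].
Proof. by rewrite modulusE [LHS]normc_def. Qed.

Lemma sqr_modulus z : modulus z ^+ 2 = complex.Re z ^+ 2 + complex.Im z ^+ 2.
Proof. by rewrite modulusE sqr_sqrtr// addr_ge0 ?sqr_ge0. Qed.

Lemma modulus_ge0 z : 0 <= modulus z.
Proof. by rewrite modulusE sqrtr_ge0. Qed.

Lemma modulusM z w : modulus (z * w) = modulus z * modulus w.
Proof. by apply: complexI; rewrite rmorphM -!normE normrM. Qed.

Lemma modulusX z n : modulus (z ^+ n) = modulus z ^+ n.
Proof. by apply: complexI; rewrite rmorphXn -!normE normrX. Qed.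

Lemma modulusV z : modulus (z^-1) = (modulus z)^-1.
Proof. by apply: complexI; rewrite fmorphV -!normE normfV. Qed.

Lemma modulusD z w : modulus (z + w) <= modulus z + modulus w.
Proof. by rewrite -lecR rmorphD -!normE ler_normD. Qed.

Lemma modulusN z : modulus (- z) = modulus z.
Proof. by apply: complexI; rewrite -!normE normrN. Qed.

Lemma modulusB z w : modulus (z - w) <= modulus z + modulus w.
Proof. by rewrite -(modulusN w) modulusD. Qed.

Lemma modulus_distC z w : modulus (z - w) = modulus (w - z).
Proof. by rewrite -modulusN opprB. Qed.

Lemma modulusC (x : R) : modulus x%:C = `|x|.
Proof. by rewrite modulusE /= expr0n addr0 sqrtr_sqr. Qed.

Lemma modulus0 : modulus (0 : Cplx R) = 0.
Proof. by rewrite (modulusC 0) normr0. Qed.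

Lemma modulus1 : modulus (1 : Cplx R) = 1.
Proof. by rewrite (modulusC 1) normr1. Qed.

Lemma modulusi : modulus ('i : Cplx R) = 1.
Proof. by rewrite modulusE /= expr0n expr1n add0r sqrtr1. Qed.

Lemma modulus_conj z : modulus (z^*) = modulus z.
Proof. by case: z => x y; rewrite !modulusE /= sqrrN. Qed.

Lemma modulus_eq0 z : (modulus z == 0) = (z == 0).
Proof. by rewrite -[RHS]normr_eq0 normE -(inj_eq (@complexI R)). Qed.

Lemma modulus_gt0 z : (0 < modulus z) = (z != 0).
Proof. by rewrite lt_def modulus_eq0 modulus_ge0 andbT. Qed.

Lemma normRe_modulus z : `|complex.Re z| <= modulus z.
Proof.
by rewrite -(ler_pXn2r (ltn0Sn 1)) ?nnegrE ?modulus_ge0// sqr_modulus real_normK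
  ?num_real// lerDl sqr_ge0.
Qed.

Lemma normIm_modulus z : `|complex.Im z| <= modulus z.
Proof.
by rewrite -(ler_pXn2r (ltn0Sn 1)) ?nnegrE ?modulus_ge0// sqr_modulus real_normK
  ?num_real// lerDr sqr_ge0.
Qed.

Lemma modulus_le_ReIm z :
  modulus z <= `|complex.Re z| + `|complex.Im z|.
Proof.
rewrite -(ler_pXn2r (ltn0Sn 1)) ?nnegrE ?modulus_ge0 ?addr_ge0// sqr_modulus.
rewrite sqrrD !real_normK ?num_real// addrAC lerDl.
by rewrite mulrn_wge0// mulr_ge0.
Qed.

(** Convergence in [R[i]] is defined with [R[i]]-valued radii; the estimates
   below have real ones. *)
Lemma cvg_modulusP T (F : set_system T) {FF : Filter F} (f : T -> Cplx R) z :
  f @ F --> z <-> forall e : R, 0 < e -> \forall x \near F, modulus (z - f x) < e.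
Proof.
split=> [/cvgrPdist_lt h e e0|h].
  have := h e%:C; rewrite ltcR => /(_ e0).
  by apply: filterS => x; rewrite normE ltcR.
apply/cvgrPdist_lt => -[e e'] ; rewrite ltcE/= => /andP[/eqP-> e0].
by have := h e e0; apply: filterS => x; rewrite normE (ltcR _ e).
Qed.

Lemma nbhs_modulusP z (P : set (Cplx R)) :
  nbhs z P <-> exists2 e : R, 0 < e & forall w, modulus (w - z) < e -> P w.
Proof.
split=> [|[e e0 eP]].
  rewrite -nbhs_ballE => -[[e e'] /=]; rewrite ltcE/= => /andP[/eqP-> e0] h.
  exists e => // w wz; apply: h; rewrite -ball_normE /=.
  by rewrite normE (ltcR _ e) modulus_distC.
have /cvg_modulusP/(_ e e0) := @cvg_id _ (nbhs z).
by apply: filterS => w wz; apply: eP; rewrite modulus_distC.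
Qed.

Lemma cvg_ReImP T (F : set_system T) {FF : Filter F} (f : T -> Cplx R) z :
  f @ F --> z <->
  (complex.Re (f x) @[x --> F] --> complex.Re z) /\
  (complex.Im (f x) @[x --> F] --> complex.Im z).
Proof.
split=> [/cvg_modulusP h|[/cvgrPdist_lt h1 /cvgrPdist_lt h2]].
  split; apply/cvgrPdist_lt => e e0; have := h e e0; apply: filterS => x;
    apply: le_lt_trans.
    by case: z (f x) {h} => a b [c d]; exact: (normRe_modulus ((a +i* b) - (c +i* d))).
  by case: z (f x) {h} => a b [c d]; exact: (normIm_modulus ((a +i* b) - (c +i* d))).
apply/cvg_modulusP => e e0.
have e20 : 0 < e / 2 by lra.
near=> x.
have a1 : `|complex.Re z - complex.Re (f x)| < e / 2 by near: x; exact: h1.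
have a2 : `|complex.Im z - complex.Im (f x)| < e / 2 by near: x; exact: h2.
apply: (le_lt_trans (modulus_le_ReIm _)).
case: (z) (f x) a1 a2 => a b [c d] /= a1 a2; lra.
Unshelve. all: by end_near. Qed.

Lemma cvg_modulus T (F : set_system T) {FF : Filter F} (f : T -> Cplx R) z :
  f @ F --> z -> modulus (f x) @[x --> F] --> modulus z.
Proof.
move=> /cvg_modulusP h; apply/cvgrPdist_lt => e e0; have := h e e0.
apply: filterS => x; apply: le_lt_trans.
have h1 := modulusD (z - f x) (f x); have h2 := modulusD (f x - z) z.
rewrite !subrK in h1 h2; rewrite modulus_distC in h2.
by rewrite ler_norml; apply/andP; split; lra.
Qed.

End Modulus.

(** * Integrals of complex functions over real segments *)

Section Integral.
Context {R : realType}.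
Local Notation mu := (@lebesgue_measure R).
Local Notation C := (Cplx R).

(** Continuity is two-sided at the end points as well: the functions integrated
   below are continuous on a neighbourhood of the segment. *)
Definition continuous_on {T : topologicalType} (a b : R) (f : R -> T) :=
  forall x, a <= x <= b -> f y @[y --> x] --> f x.

Definition itv_integral (f : R -> R) (a b : R) : R :=
  \int[mu]_(x in `[a, b]) f x.

Lemma continuous_on_integrable (f : R -> R) a b : continuous_on a b f ->
  mu.-integrable `[a, b] (EFin \o f).
Proof.
move=> cf; apply: continuous_compact_integrable; first exact: segment_compact.
apply: continuous_in_subspaceT => x; rewrite inE/= in_itv/= => xab.
exact: cf.
Qed.

Lemma itv_integral_split (f : R -> R) a b c : a <= b -> b <= c ->
  continuous_on a c f ->
  itv_integral f a c = itv_integral f a b + itv_integral f b c.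
Proof.
move=> ab bc cf; have icf := continuous_on_integrable cf.
have := @Rintegral_itvB R f (BLeft a) (BRight c) b icf.
rewrite !bnd_simp => /(_ ab bc).
rewrite -/(itv_integral f a c) -/(itv_integral f a b) => /eqP.
rewrite subr_eq addrC => /eqP ->; congr (_ + _).
apply: Rintegral_itv_obnd_cbnd; apply: integrableS icf => //.
by apply: subset_itv; rewrite bnd_simp.
Qed.

Lemma itv_integralD (f g : R -> R) a b : continuous_on a b f -> continuous_on a b g ->
  itv_integral (fun x => f x + g x) a b = itv_integral f a b + itv_integral g a b.
Proof.
by move=> cf cg; apply: RintegralD => //; exact: continuous_on_integrable.
Qed.

Lemma itv_integralZ (f : R -> R) k a b : continuous_on a b f ->
  itv_integral (fun x => k * f x) a b = k * itv_integral f a b.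
Proof. by move=> cf; apply: RintegralZl => //; exact: continuous_on_integrable. Qed.

Lemma itv_integral_cst k a b : a <= b -> itv_integral (cst k) a b = k * (b - a).
Proof.
move=> ab; rewrite /itv_integral Rintegral_cst//= lebesgue_measure_itv/= lte_fin.
move: ab; rewrite le_eqVlt => /predU1P[->|->]; last by rewrite -EFinB.
by rewrite ltxx subrr.
Qed.

Lemma le_itv_integral (f g : R -> R) a b : continuous_on a b f -> continuous_on a b g ->
  (forall x, a <= x <= b -> f x <= g x) -> itv_integral f a b <= itv_integral g a b.
Proof.
move=> cf cg fg; apply: le_Rintegral => //; try exact: continuous_on_integrable.
Qed.

Lemma norm_itv_integral_le (f : R -> R) a b B : a <= b -> continuous_on a b f ->
  (forall x, a <= x <= b -> `|f x| <= B) -> `|itv_integral f a b| <= B * (b - a).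
Proof.
move=> ab cf fB.
have cB k : continuous_on a b (cst k : R -> R) by move=> x _; exact: cvg_cst.
rewrite ler_norml -mulNr -!itv_integral_cst//; apply/andP; split;
  by apply: le_itv_integral => // x /fB; rewrite ler_norml => /andP[].
Qed.

Lemma itv_integral_id a b : a <= b -> itv_integral id a b = (b ^+ 2 - a ^+ 2) / 2.
Proof.
rewrite le_eqVlt => /predU1P[->|ab].
  by rewrite subrr mul0r /itv_integral set_itv1 Rintegral_set1.
pose F (x : R) := x ^+ 2 / 2.
have dF x : is_derive x (1 : R) F x.
  rewrite /F; apply: is_derive_eq.
  rewrite /GRing.scale/=; lra.
rewrite /itv_integral /Rintegral (@continuous_FTC2 _ id F)//.
- by rewrite /F/=; lra.
- by apply: continuous_subspaceT => ?; exact: cvg_id.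
- split.
  + by move=> x _; exact: (@ex_derive _ _ _ _ _ _ _ (dF x)).
  + apply: cvg_at_right_filter; apply: differentiable_continuous.
    by apply/derivable1_diffP; exact: (@ex_derive _ _ _ _ _ _ _ (dF a)).
  + apply: cvg_at_left_filter; apply: differentiable_continuous.
    by apply/derivable1_diffP; exact: (@ex_derive _ _ _ _ _ _ _ (dF b)).
- by move=> x _; rewrite derive1E; exact: derive_val.
Qed.

Definition itv_cintegral (g : R -> C) (a b : R) : C :=
  itv_integral (fun x => complex.Re (g x)) a b +i*
  itv_integral (fun x => complex.Im (g x)) a b.

Lemma continuous_on_Re (g : R -> C) a b : continuous_on a b g ->
  continuous_on a b (fun x => complex.Re (g x)).
Proof. by move=> cg x /cg /cvg_ReImP[]. Qed.

Lemma continuous_on_Im (g : R -> C) a b : continuous_on a b g ->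
  continuous_on a b (fun x => complex.Im (g x)).
Proof. by move=> cg x /cg /cvg_ReImP[]. Qed.

Local Hint Resolve continuous_on_Re continuous_on_Im : core.

Lemma itv_cintegral_split (g : R -> C) a b c : a <= b -> b <= c ->
  continuous_on a c g -> itv_cintegral g a c = itv_cintegral g a b + itv_cintegral g b c.
Proof.
by move=> ab bc cg; rewrite /itv_cintegral !(itv_integral_split ab bc); auto.
Qed.

Lemma eq_itv_cintegral (f g : R -> C) a b : (forall x, a <= x <= b -> f x = g x) ->
  itv_cintegral f a b = itv_cintegral g a b.
Proof.
by move=> fg; rewrite /itv_cintegral; congr (_ +i* _); apply: eq_Rintegral => x;
  rewrite inE/= in_itv/= => /fg->.
Qed.

Lemma itv_cintegralD (f g : R -> C) a b : continuous_on a b f -> continuous_on a b g ->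
  itv_cintegral (fun x => f x + g x) a b = itv_cintegral f a b + itv_cintegral g a b.
Proof.
move=> cf cg; rewrite /itv_cintegral.
apply/eqP; rewrite eq_complex/= -!itv_integralD; auto; apply/andP; split; apply/eqP;
  congr (itv_integral _ _ _); apply/funext => x;
  by case: (f x) (g x) => ? ? [].
Qed.

Lemma continuous_onZ (f : R -> R) (k : R) a b : continuous_on a b f ->
  continuous_on a b (fun x => k * f x).
Proof. by move=> cf x /cf; exact: cvgMl_tmp. Qed.

Local Hint Resolve continuous_onZ : core.

Lemma itv_cintegralZ (k : C) (g : R -> C) a b : continuous_on a b g ->
  itv_cintegral (fun x => k * g x) a b = k * itv_cintegral g a b.
Proof.
case: k => k1 k2 cg; rewrite /itv_cintegral; apply/eqP; rewrite eq_complex/=.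
rewrite -mulNr -!itv_integralZ; auto.
rewrite -!itv_integralD; auto; apply/andP; split; apply/eqP;
  congr (itv_integral _ _ _); apply/funext => x;
  by case: (g x) => ? ?; rewrite /= ?mulNr.
Qed.

(** The factor two comes from integrating the real and imaginary parts
   separately; only the order of magnitude matters below. *)
Lemma modulus_itv_cintegral (g : R -> C) a b B : a <= b -> continuous_on a b g ->
  (forall x, a <= x <= b -> modulus (g x) <= B) ->
  modulus (itv_cintegral g a b) <= 2 * B * (b - a).
Proof.
move=> ab cg gB; apply: (le_trans (modulus_le_ReIm _)) => /=.
rewrite -mulrA mulrDl mul1r lerD// norm_itv_integral_le; auto => x /gB.
- exact/le_trans/normRe_modulus.
- exact/le_trans/normIm_modulus.
Qed.

Lemma continuous_on_real_complex a b : continuous_on a b (fun x : R => x%:C : C).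
Proof. by move=> x _; apply/cvg_ReImP => /=; split; [exact: cvg_id|exact: cvg_cst]. Qed.

Lemma itv_cintegral_cst (k : C) a b : a <= b -> itv_cintegral (cst k) a b = k * (b - a)%:C.
Proof.
move=> ab; rewrite /itv_cintegral !itv_integral_cst//.
by case: k => k1 k2; apply/eqP; rewrite eq_complex/=; apply/andP; split; apply/eqP; ring.
Qed.

Lemma itv_cintegral_id a b : a <= b ->
  itv_cintegral (fun x => x%:C) a b = ((b ^+ 2 - a ^+ 2) / 2)%:C.
Proof.
by move=> ab; rewrite /itv_cintegral/= itv_integral_id// (itv_integral_cst 0)// mul0r.
Qed.

Lemma itv_cintegral_affine (k l : C) a b : a <= b ->
  itv_cintegral (fun x => k + l * x%:C) a b =
  k * (b - a)%:C + l * ((b ^+ 2 - a ^+ 2) / 2)%:C.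
Proof.
move=> ab; rewrite itv_cintegralD ?itv_cintegral_cst ?itv_cintegralZ ?itv_cintegral_id//.
- exact: continuous_on_real_complex.
- by move=> x _; exact: cvg_cst.
- by move=> x xab; apply: cvgMl_tmp; exact: (@continuous_on_real_complex a b).
Qed.

End Integral.

(** * Integrals along the frame of a rectangle *)

Section Goursat.
Context {R : realType}.
Local Notation C := (Cplx R).
Implicit Types (F : C -> C) (z w : C).

(** Complex differentiability as a first-order expansion with real radii, the
   form that the local estimate of Goursat's theorem uses. *)
Lemma differentiable_linear_approx F z : differentiable F z ->
  exists d : C, forall e : R, 0 < e -> exists2 r : R, 0 < r &
    forall w, modulus (w - z) < r ->
      modulus (F w - F z - d * (w - z)) <= e * modulus (w - z).
Proof.
move=> /derivable1_diffP dF; exists ('D_1 F z) => e e0.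
have /cvg_modulusP/(_ e e0) := dF.
rewrite near_withinE => /nbhs_modulusP[r r0 rP]; exists r => // w wr.
have [->|wz] := eqVneq w z; first by rewrite !subrr mulr0 subr0 modulus0 mulr0.
have wz0 : w - z != 0 by rewrite subr_eq0.
have := rP (w - z); rewrite subr0 => /(_ wr wz0).
rewrite -/('D_1 F z) => h.
have -> : F w - F z - 'D_1 F z * (w - z) =
    - (('D_1 F z - (w - z)^-1 *: (F ((w - z)%:A + z) - F z)) * (w - z)).
  have -> : (w - z)%:A = w - z :> C by rewrite /GRing.scale/= mulr1.
  rewrite subrK /GRing.scale/= mulrBl mulrAC mulVf// mul1r; ring.
by rewrite modulusN modulusM ler_wpM2r ?modulus_ge0// ltW.
Qed.

Definition in_rect (x0 x1 y0 y1 : R) z :=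
  x0 <= complex.Re z <= x1 /\ y0 <= complex.Im z <= y1.

Definition on_frame (x0 x1 y0 y1 : R) z :=
  in_rect x0 x1 y0 y1 z /\
  [\/ complex.Re z = x0, complex.Re z = x1, complex.Im z = y0 | complex.Im z = y1].

Definition frame_integral F (x0 x1 y0 y1 : R) : C :=
  itv_cintegral (fun x => F (x +i* y0)) x0 x1 +
  'i * itv_cintegral (fun y => F (x1 +i* y)) y0 y1 -
  itv_cintegral (fun x => F (x +i* y1)) x0 x1 -
  'i * itv_cintegral (fun y => F (x0 +i* y)) y0 y1.

Definition continuous_on_frame F x0 x1 y0 y1 :=
  forall z, on_frame x0 x1 y0 y1 z -> F w @[w --> z] --> F z.

Lemma frame_edges F x0 x1 y0 y1 : x0 <= x1 -> y0 <= y1 ->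
  continuous_on_frame F x0 x1 y0 y1 ->
  [/\ continuous_on x0 x1 (fun x => F (x +i* y0)),
      continuous_on y0 y1 (fun y => F (x1 +i* y)),
      continuous_on x0 x1 (fun x => F (x +i* y1)) &
      continuous_on y0 y1 (fun y => F (x0 +i* y))].
Proof.
move=> x01 y01 cF.
have cx (y x : R) : (t +i* y : C) @[t --> x] --> (x +i* y : C).
  by apply/cvg_ReImP; split => /=; [exact: cvg_id|exact: cvg_cst].
have cy (x y : R) : (x +i* t : C) @[t --> y] --> (x +i* y : C).
  by apply/cvg_ReImP; split => /=; [exact: cvg_cst|exact: cvg_id].
split=> t /andP[t0 t1].
- apply: (cvg_comp _ _ (cx y0 t)); apply: cF; split; last by apply: Or43.
  by split; rewrite /= ?t0 ?t1 ?lexx.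
- apply: (cvg_comp _ _ (cy x1 t)); apply: cF; split; last by apply: Or42.
  by split; rewrite /= ?t0 ?t1 ?lexx ?x01.
- apply: (cvg_comp _ _ (cx y1 t)); apply: cF; split; last by apply: Or44.
  by split; rewrite /= ?t0 ?t1 ?lexx ?y01.
- apply: (cvg_comp _ _ (cy x0 t)); apply: cF; split; last by apply: Or41.
  by split; rewrite /= ?t0 ?t1 ?lexx ?x01.
Qed.

Lemma frame_integral_bound F x0 x1 y0 y1 B : x0 <= x1 -> y0 <= y1 ->
  continuous_on_frame F x0 x1 y0 y1 ->
  (forall z, on_frame x0 x1 y0 y1 z -> modulus (F z) <= B) ->
  modulus (frame_integral F x0 x1 y0 y1) <= 4 * B * ((x1 - x0) + (y1 - y0)).
Proof.
move=> x01 y01 cF FB; have [c1 c2 c3 c4] := frame_edges x01 y01 cF.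
have b1 := modulus_itv_cintegral x01 c1 (B := B).
have b2 := modulus_itv_cintegral y01 c2 (B := B).
have b3 := modulus_itv_cintegral x01 c3 (B := B).
have b4 := modulus_itv_cintegral y01 c4 (B := B).
have {}b1 : modulus (itv_cintegral (fun x => F (x +i* y0)) x0 x1) <= 2 * B * (x1 - x0).
  apply: b1 => t /andP[t0 t1]; apply: FB; split; last by apply: Or43.
  by split; rewrite /= ?t0 ?t1 ?lexx.
have {}b2 : modulus (itv_cintegral (fun y => F (x1 +i* y)) y0 y1) <= 2 * B * (y1 - y0).
  apply: b2 => t /andP[t0 t1]; apply: FB; split; last by apply: Or42.
  by split; rewrite /= ?t0 ?t1 ?lexx ?x01.
have {}b3 : modulus (itv_cintegral (fun x => F (x +i* y1)) x0 x1) <= 2 * B * (x1 - x0).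
  apply: b3 => t /andP[t0 t1]; apply: FB; split; last by apply: Or44.
  by split; rewrite /= ?t0 ?t1 ?lexx ?y01.
have {}b4 : modulus (itv_cintegral (fun y => F (x0 +i* y)) y0 y1) <= 2 * B * (y1 - y0).
  apply: b4 => t /andP[t0 t1]; apply: FB; split; last by apply: Or41.
  by split; rewrite /= ?t0 ?t1 ?lexx ?x01.
rewrite /frame_integral.
apply: (le_trans (modulusB _ _)); rewrite modulusM modulusi mul1r.
apply: (le_trans (lerD (modulusB _ _) b4)).
apply: (le_trans (lerD (lerD (modulusD _ _) b3) (lexx _))).
rewrite modulusM modulusi mul1r.
lra.
Qed.

Lemma frame_integralD F G x0 x1 y0 y1 : x0 <= x1 -> y0 <= y1 ->
  continuous_on_frame F x0 x1 y0 y1 -> continuous_on_frame G x0 x1 y0 y1 ->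
  frame_integral (fun z => F z + G z) x0 x1 y0 y1 =
  frame_integral F x0 x1 y0 y1 + frame_integral G x0 x1 y0 y1.
Proof.
move=> x01 y01 /(frame_edges x01 y01)[f1 f2 f3 f4] /(frame_edges x01 y01)[g1 g2 g3 g4].
rewrite /frame_integral (itv_cintegralD f1 g1) (itv_cintegralD f2 g2).
rewrite (itv_cintegralD f3 g3) (itv_cintegralD f4 g4) !mulrDr; move: ('i * _) => e1.
move: ('i * _) => e2.
move: (itv_cintegral _ _ _) => e3.
move: (itv_cintegral _ _ _) => e4. ring.
Qed.

Lemma frame_integralZ (k : C) F x0 x1 y0 y1 : x0 <= x1 -> y0 <= y1 ->
  continuous_on_frame F x0 x1 y0 y1 ->
  frame_integral (fun z => k * F z) x0 x1 y0 y1 =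
  k * frame_integral F x0 x1 y0 y1.
Proof.
move=> x01 y01 /(frame_edges x01 y01)[f1 f2 f3 f4].
rewrite /frame_integral (itv_cintegralZ k f1) (itv_cintegralZ k f2).
by rewrite (itv_cintegralZ k f3) (itv_cintegralZ k f4) !mulrBr mulrDr !(mulrCA k).
Qed.

Lemma eq_frame_integral F G x0 x1 y0 y1 : x0 <= x1 -> y0 <= y1 ->
  (forall z, on_frame x0 x1 y0 y1 z -> F z = G z) ->
  frame_integral F x0 x1 y0 y1 = frame_integral G x0 x1 y0 y1.
Proof.
move=> x01 y01 FG; rewrite /frame_integral.
congr (_ + _ * _ - _ - _ * _); apply: eq_itv_cintegral => t /andP[t0 t1]; apply: FG.
- split; last by apply: Or43.
  by split; rewrite /= ?t0 ?t1 ?lexx.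
- split; last by apply: Or42.
  by split; rewrite /= ?t0 ?t1 ?lexx ?x01.
- split; last by apply: Or44.
  by split; rewrite /= ?t0 ?t1 ?lexx ?y01.
- split; last by apply: Or41.
  by split; rewrite /= ?t0 ?t1 ?lexx ?x01.
Qed.

Lemma complex_rect (x y : R) : x +i* y = x%:C + 'i * y%:C :> C.
Proof. by rewrite [LHS]complexE. Qed.

(** With the first-order expansion, this reduces the integral over a small frame to
   that of the remainder. *)
Lemma frame_integral_affine (k l : C) x0 x1 y0 y1 : x0 <= x1 -> y0 <= y1 ->
  frame_integral (fun z => k + l * z) x0 x1 y0 y1 = 0.
Proof.
move=> x01 y01; rewrite /frame_integral.
have hx (y : R) : (fun x : R => k + l * (x +i* y)) =
    (fun x : R => (k + l * ('i * y%:C)) + l * x%:C).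
  by apply/funext => x; rewrite complex_rect mulrDr addrA addrAC.
have hy (x : R) : (fun y : R => k + l * (x +i* y)) =
    (fun y : R => (k + l * x%:C) + (l * 'i) * y%:C).
  by apply/funext => y; rewrite complex_rect mulrDr addrA mulrA.
rewrite !hx !hy !itv_cintegral_affine// !rmorphM !rmorphB !rmorphXn/=.
rewrite fmorphV rmorph_nat.
have -> : (l * 'i : C) * ((y1%:C ^+ 2 - y0%:C ^+ 2) * 2^-1) =
  'i * (l * ((y1%:C ^+ 2 - y0%:C ^+ 2) * 2^-1)) by ring.
ring.
Qed.

Lemma frame_integral_splitx F x0 m x1 y0 y1 : x0 <= m -> m <= x1 -> y0 <= y1 ->
  continuous_on_frame F x0 x1 y0 y1 ->
  frame_integral F x0 x1 y0 y1 =
  frame_integral F x0 m y0 y1 + frame_integral F m x1 y0 y1.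
Proof.
move=> xm mx y01 cF.
have [c1 c2 c3 c4] := frame_edges (le_trans xm mx) y01 cF.
rewrite /frame_integral (itv_cintegral_split xm mx c1) (itv_cintegral_split xm mx c3).
ring.
Qed.

Lemma frame_integral_splity F x0 x1 y0 m y1 : y0 <= m -> m <= y1 -> x0 <= x1 ->
  continuous_on_frame F x0 x1 y0 y1 ->
  frame_integral F x0 x1 y0 y1 =
  frame_integral F x0 x1 y0 m + frame_integral F x0 x1 m y1.
Proof.
move=> ym my x01 cF.
have [c1 c2 c3 c4] := frame_edges x01 (le_trans ym my) cF.
rewrite /frame_integral (itv_cintegral_split ym my c2) (itv_cintegral_split ym my c4).
ring.
Qed.

End Goursat.

Section ComplexDifferentiability.
Context {R : realType}.
Local Notation C := (Cplx R).
Implicit Types (f g : C -> C) (z k : C).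

Lemma cdiff_cst k z : differentiable (fun _ : C => k) z.
Proof. exact: differentiable_cst. Qed.

Lemma cdiff_id z : differentiable (fun w : C => w) z.
Proof. by apply/derivable1_diffP; exact: derivable_id. Qed.

Lemma cdiffD f g z : differentiable f z -> differentiable g z ->
  differentiable (fun w => f w + g w) z.
Proof. exact: differentiableD. Qed.

Lemma cdiffB f g z : differentiable f z -> differentiable g z ->
  differentiable (fun w => f w - g w) z.
Proof. exact: differentiableB. Qed.

Lemma cdiffM f g z : differentiable f z -> differentiable g z ->
  differentiable (fun w => f w * g w) z.
Proof. exact: differentiableM. Qed.

Lemma cdiffX f n z : differentiable f z -> differentiable (fun w => f w ^+ n) z.
Proof.
move=> df; elim: n => [|n IHn]; first exact: cdiff_cst.
by under eq_fun do rewrite exprS; exact: cdiffM.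
Qed.

Lemma cdiff_div f g z : differentiable f z -> differentiable g z -> g z != 0 ->
  differentiable (fun w => f w / g w) z.
Proof. by move=> df dg g0; exact: (cdiffM df (differentiableV dg g0)). Qed.

Lemma cdiff_continuous f z : differentiable f z -> f w @[w --> z] --> f z.
Proof. exact: differentiable_continuous. Qed.

Lemma cdiff_affine k l z : differentiable (fun w : C => k + l * w) z.
Proof. exact: (cdiffD (cdiff_cst k z) (cdiffM (cdiff_cst l z) (cdiff_id z))). Qed.

End ComplexDifferentiability.

(** * Goursat's theorem for rectangles *)

Section GoursatTheorem.
Context {R : realType}.
Local Notation C := (Cplx R).
Implicit Types (F : C -> C) (z w : C).

Lemma differentiable_frame F x0 x1 y0 y1 :
  (forall z, in_rect x0 x1 y0 y1 z -> differentiable F z) ->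
  continuous_on_frame F x0 x1 y0 y1.
Proof. by move=> dF z [/dF dFz _]; exact: cdiff_continuous. Qed.

Lemma in_rectS (a b c d a' b' c' d' : R) z :
  a' <= a -> b <= b' -> c' <= c -> d <= d' ->
  in_rect a b c d z -> in_rect a' b' c' d' z.
Proof.
move=> h1 h2 h3 h4 [/andP[i1 i2] /andP[i3 i4]].
by split; apply/andP; split; lra.
Qed.

(** The affine part of [F] at [p] integrates to zero, and the remainder is at most
   [e * (w + h)] on a frame of half-perimeter [w + h]. *)
Lemma goursat_local F p (e : R) : differentiable F p -> 0 < e ->
  exists2 r : R, 0 < r & forall a b w h : R, 0 <= w -> 0 <= h -> w + h < r ->
    in_rect a (a + w) b (b + h) p ->
    continuous_on_frame F a (a + w) b (b + h) ->
    modulus (frame_integral F a (a + w) b (b + h)) <= 4 * e * (w + h) ^+ 2.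
Proof.
move=> /differentiable_linear_approx[d hd] e0; have [r r0 hr] := hd e e0.
exists r => // a b w h w0 h0 whr pab cF.
have aw : a <= a + w by lra.
have bh : b <= b + h by lra.
pose G z := F z + (- (F p - d * p) + (- d) * z).
have cA : continuous_on_frame (fun z => - (F p - d * p) + (- d) * z) a (a + w) b (b + h).
  by move=> z _; exact: (cdiff_continuous (cdiff_affine _ _ _)).
have -> : frame_integral F a (a + w) b (b + h) = frame_integral G a (a + w) b (b + h).
  by rewrite frame_integralD// frame_integral_affine// addr0.
have cG : continuous_on_frame G a (a + w) b (b + h).
  by move=> z zf; exact: (cvgD (cF z zf) (cA z zf)).
apply: (le_trans (frame_integral_bound (B := e * (w + h)) aw bh cG _)); last first.
  by rewrite ![_ + _ - _]addrAC !subrr !add0r expr2 !mulrA.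
move=> z [zf _]; have zp : modulus (z - p) <= w + h.
  apply: (le_trans (modulus_le_ReIm _)).
  move: zf pab; rewrite /in_rect.
  case: (z) (p) => z1 z2 [p1 p2] /= ? ?.
  by rewrite lerD// ler_norml; lra.
have := hr z (le_lt_trans zp whr).
have -> : F z - F p - d * (z - p) = G z by rewrite /G; ring.
move=> /le_trans; apply; by rewrite ler_wpM2l// ltW.
Qed.

(** The four quarters have integrals adding up to the whole, so one of them
   carries at least a quarter of its modulus. *)
Lemma goursat_bisection F (a b w h k : R) : 0 <= w -> 0 <= h ->
  (forall a' b' c' d', a <= a' -> b' <= a + w + w -> b <= c' -> d' <= b + h + h ->
    continuous_on_frame F a' b' c' d') ->
  4 * k <= modulus (frame_integral F a (a + w + w) b (b + h + h)) ->
  exists q : R * R, [/\ q.1 = a \/ q.1 = a + w, q.2 = b \/ q.2 = b + h &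
    k <= modulus (frame_integral F q.1 (q.1 + w) q.2 (q.2 + h))].
Proof.
move=> w0 h0 cF.
have aw : a <= a + w by lra.
have aww : a + w <= a + w + w by lra.
have bh : b <= b + h by lra.
have bhh : b + h <= b + h + h by lra.
have aww' := le_trans aw aww; have bhh' := le_trans bh bhh.
rewrite (@frame_integral_splitx _ F a (a + w))//; last exact: cF.
rewrite (@frame_integral_splity _ F a (a + w) b (b + h))//; last exact: cF.
rewrite (@frame_integral_splity _ F _ (a + w + w) b (b + h))//; last exact: cF.
set J1 := frame_integral F a _ b _; set J2 := frame_integral F a _ _ _.
set J3 := frame_integral F _ _ b _; set J4 := frame_integral F _ _ _ _.
move=> kJ.
have [h1|h1] := lerP k (modulus J1); first by exists (a, b); split => //; left.
have [h2|h2] := lerP k (modulus J2).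
  by exists (a, b + h); split => //; [left|right].
have [h3|h3] := lerP k (modulus J3).
  by exists (a + w, b); split => //; [right|left].
have [h4|h4] := lerP k (modulus J4).
  by exists (a + w, b + h); split => //; right.
have := modulusD (J1 + J2) (J3 + J4).
have := modulusD J1 J2; have := modulusD J3 J4.
move: (modulus J1) (modulus J2) (modulus J3) (modulus J4) (modulus (J1 + J2))
  (modulus (J3 + J4)) (modulus (J1 + J2 + (J3 + J4))) kJ h1 h2 h3 h4.
by clear => *; exfalso; lra.
Qed.

(** Bisect repeatedly, keeping a quarter given by [goursat_bisection]: after [n]
   steps the integral is at least [c / 4 ^ n] over a frame of size [s / 2 ^ n].
   The rectangles shrink to a point, where the local estimate makes the
   integral smaller than that. *)
Theorem goursat F x0 x1 y0 y1 : x0 <= x1 -> y0 <= y1 ->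
  (forall z, in_rect x0 x1 y0 y1 z -> differentiable F z) ->
  frame_integral F x0 x1 y0 y1 = 0.
Proof.
move=> x01 y01 dF; apply/eqP; rewrite -modulus_eq0; apply/negPn/negP => J0.
pose W n : R := (x1 - x0) / 2 ^+ n; pose H n : R := (y1 - y0) / 2 ^+ n.
have WS n : W n = W n.+1 + W n.+1.
  by rewrite /W exprS; field; rewrite ?pnatr_eq0// expf_neq0// pnatr_eq0.
have HS n : H n = H n.+1 + H n.+1.
  by rewrite /H exprS; field; rewrite ?pnatr_eq0// expf_neq0// pnatr_eq0.
have W0 n : 0 <= W n by rewrite divr_ge0 ?exprn_ge0// subr_ge0.
have H0 n : 0 <= H n by rewrite divr_ge0 ?exprn_ge0// subr_ge0.
pose J n (q : R * R) := frame_integral F q.1 (q.1 + W n) q.2 (q.2 + H n).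
pose c : R := modulus (frame_integral F x0 x1 y0 y1).
have c0 : 0 < c by rewrite lt_neqAle eq_sym J0 modulus_ge0.
pose inside n (q : R * R) := [/\ x0 <= q.1, q.1 + W n <= x1, y0 <= q.2 & q.2 + H n <= y1].
pose bad n q := inside n q /\ c / 4 ^+ n <= modulus (J n q).
have step n q : bad n q -> exists q', bad n.+1 q' /\
    [/\ q.1 <= q'.1, q'.1 + W n.+1 <= q.1 + W n, q.2 <= q'.2 & q'.2 + H n.+1 <= q.2 + H n].
  case: q => a b [/= [/= i1 i2 i3 i4] cJ].
  have w0 := W0 n.+1; have h0 := H0 n.+1.
  have eW := WS n; have eH := HS n.
  have dsub a' b' c' d' : x0 <= a' -> b' <= x1 -> y0 <= c' -> d' <= y1 ->
      continuous_on_frame F a' b' c' d'.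
    move=> h1 h2 h3 h4; apply: differentiable_frame => z zi; apply: dF.
    by move: zi; exact: in_rectS.
  move: cJ; rewrite /J/= eW eH !addrA => cJ.
  rewrite eW addrA in i2 *; rewrite eH addrA in i4 *.
  have [||a' b' c' d' ? ? ? ?||q [q1 q2 kq]] :=
    @goursat_bisection F a b (W n.+1) (H n.+1) (c / 4 ^+ n.+1) => //.
  - by apply: dsub; [exact: le_trans i1 _|exact: le_trans _ i2
      |exact: le_trans i3 _|exact: le_trans _ i4].
  - apply: le_trans cJ; by rewrite exprS invfM mulrCA mulVKf ?pnatr_eq0.
  exists q; move: q q1 q2 kq {eW eH cJ dsub} => [a' b'] /= q1 q2 kq.
  rewrite /bad /inside /J/=.
  move: (W n.+1) (H n.+1) i2 i4 w0 h0 q1 q2 kq => w h i2 i4 w0 h0 q1 q2 kq.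
  split; [split; last exact: kq|].
    by case: q1 q2 => -> [] ->; split => /=; clear -i1 i2 i3 i4 w0 h0; lra.
  by case: q1 q2 => -> [] ->; split; clear -w0 h0; lra.
(* The choice of a quarter is made total by staying put on other rectangles.
   *)
pose next n q := if pselect (bad n q) is left b then sval (cid (step n q b)) else q.
pose q := fix q n := if n is m.+1 then next m (q m) else (x0, y0).
have qbad n : bad n (q n).
  elim: n => [|n IH] /=.
    rewrite /bad /inside /J /W /H /= !expr0 !divr1 [x0 + _]addrC [y0 + _]addrC !subrK.
    by split => //; split.
  by rewrite /next; case: pselect => // b; case: cid => /= ? [].
have qstep n : [/\ (q n).1 <= (q n.+1).1, (q n.+1).1 + W n.+1 <= (q n).1 + W n,
    (q n).2 <= (q n.+1).2 & (q n.+1).2 + H n.+1 <= (q n).2 + H n].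
  have := qbad n; rewrite /= /next; case: pselect => // b _; case: cid => /= ? [].
  by [].
have nest n k : [/\ (q n).1 <= (q (n + k)%N).1, (q (n + k)%N).1 + W (n + k)%N <= (q n).1 + W n,
    (q n).2 <= (q (n + k)%N).2 & (q (n + k)%N).2 + H (n + k)%N <= (q n).2 + H n].
  elim: k => [|k [e1 e2 e3 e4]]; first by rewrite addn0; split; rewrite ?lexx.
  have [s1 s2 s3 s4] := qstep (n + k)%N; rewrite addnS.
  by split; [exact: le_trans e1 s1|exact: le_trans s2 e2
    |exact: le_trans e3 s3|exact: le_trans s4 e4].
have cross n m : (q n).1 <= (q m).1 + W m /\ (q n).2 <= (q m).2 + H m.
  have [nm|/ltnW nm] := leqP n m.
    have [e1 _ e2 _] := nest n (m - n)%N; rewrite subnKC// in e1 e2.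
    by split; [apply: (le_trans e1)|apply: (le_trans e2)]; rewrite lerDl.
  have [_ e1 _ e2] := nest m (n - m)%N; rewrite subnKC// in e1 e2.
  by split; [apply: le_trans e1|apply: le_trans e2]; rewrite lerDl.
pose p1 := sup [set (q n).1 | n in setT]; pose p2 := sup [set (q n).2 | n in setT].
have pin n : in_rect (q n).1 ((q n).1 + W n) (q n).2 ((q n).2 + H n) (p1 +i* p2).
  split; apply/andP; split => /=.
  - apply: ub_le_sup; last by exists n.
    by exists ((q 0%N).1 + W 0%N) => _ [m _ <-]; exact: (cross m 0%N).1.
  - apply: ge_sup; first by exists (q 0%N).1; exists 0%N.
    by move=> _ [m _ <-]; exact: (cross m n).1.
  - apply: ub_le_sup; last by exists n.
    by exists ((q 0%N).2 + H 0%N) => _ [m _ <-]; exact: (cross m 0%N).2.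
  - apply: ge_sup; first by exists (q 0%N).2; exists 0%N.
    by move=> _ [m _ <-]; exact: (cross m n).2.
have dp : differentiable F (p1 +i* p2 : C).
  apply: dF; have [[? ? ? ?] _] := qbad 0%N.
  by apply: in_rectS (pin 0%N).
pose s := (x1 - x0) + (y1 - y0).
have s0 : 0 <= s by rewrite /s; lra.
(* Any constant smaller than [c / (4 s^2)] would do; adding [4] avoids the
   case [s = 0]. *)
have [r r0 hr] := @goursat_local F _ (c / (4 * s ^+ 2 + 4)) dp
  (divr_gt0 c0 (ltr_wpDl (mulr_ge0 (ler0n _ 4) (sqr_ge0 s)) (ltr0n _ 4))).
have [n nr] : exists n, W n + H n < r.
  have /cvgrPdist_lt/(_ r r0) : s / 2 ^+ n @[n --> \oo] --> (0 : R).
    rewrite -(mulr0 s); apply: cvgMl_tmp.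
    under eq_fun do rewrite -exprVn.
    by apply: cvg_expr; rewrite ger0_norm; lra.
  case=> n _ /(_ n (leqnn n)); rewrite sub0r normrN => h.
  by exists n; rewrite /W /H -mulrDl (le_lt_trans (ler_norm _) h).
have [[i1 i2 i3 i4] cJ] := qbad n.
have := hr _ _ _ _ (W0 n) (H0 n) nr (pin n).
have -> : W n + H n = s / 2 ^+ n by rewrite /W /H -mulrDl.
move=> h; have {h}: modulus (J n (q n)) <= 4 * (c / (4 * s ^+ 2 + 4)) * (s / 2 ^+ n) ^+ 2.
  apply: h; apply: differentiable_frame => z zi; apply: dF.
  by apply: in_rectS zi.
move=> /(le_trans cJ); apply/negP; rewrite -ltNge.
have -> : (s / 2 ^+ n) ^+ 2 = s ^+ 2 / 4 ^+ n.
  have -> : 4 = 2 ^+ 2 :> R by ring.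
  by rewrite expr_div_n -!exprM mulnC.
rewrite mulrA ltr_pM2r ?invr_gt0 ?exprn_gt0//.
have := sqr_ge0 s; move: (s ^+ 2) => u u0.
have -> : 4 * (c / (4 * u + 4)) * u = c * (u / (u + 1)) by field; lra.
by rewrite gtr_pMr// ltr_pdivrMr; lra.
Qed.

End GoursatTheorem.

(** * The maximum principle on a rectangle *)

Section FrameKernel.
Context {R : realType}.
Local Notation C := (Cplx R).
Implicit Types (f g h K : C -> C) (z w a p : C).

(** A function that vanishes to second order has derivative zero; this is how
   exceptional points are absorbed. *)
Lemma differentiable_quadratic K p (r B : R) : 0 < r ->
  (forall w, modulus (w - p) < r -> modulus (K w) <= B * modulus (w - p) ^+ 2) ->
  differentiable K p.
Proof.
move=> r0 KB.
have Kp : K p = 0.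
  apply/eqP; rewrite -modulus_eq0 eq_le modulus_ge0 andbT.
  by have := KB p; rewrite subrr modulus0 expr0n mulr0; exact.
apply/derivable1_diffP; apply/cvg_ex; exists (0 : C).
apply/cvg_modulusP => e e0.
have s0 : 0 < Num.min r (e / (`|B| + 1)).
  by rewrite lt_min r0 divr_gt0// ltr_wpDl.
rewrite near_withinE; apply/nbhs_modulusP; exists (Num.min r (e / (`|B| + 1))) => //.
move=> w; rewrite subr0 lt_min => /andP[wr we] w0.
rewrite sub0r modulusN Kp subr0 [_ *: _]/GRing.scale/= modulusM modulusV.
have -> : w%:A = w :> C by rewrite /GRing.scale/= mulr1.
have := KB (w + p); rewrite addrK => /(_ wr) h.
have mw : 0 < modulus w by rewrite modulus_gt0.
rewrite mulrC ltr_pdivrMr//; apply: (le_lt_trans h).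
rewrite expr2 mulrA ltr_pM2r//.
apply: (@le_lt_trans _ _ ((`|B| + 1) * modulus w)).
  by rewrite ler_wpM2r ?modulus_ge0// (le_trans (ler_norm _))// lerDl.
by rewrite mulrC -ltr_pdivlMr// ltr_wpDl.
Qed.

Lemma differentiable_lipschitz f p : differentiable f p ->
  exists r c : R, [/\ 0 < r, 0 <= c & forall w, modulus (w - p) < r ->
    modulus (f w - f p) <= c * modulus (w - p)].
Proof.
move=> /differentiable_linear_approx[d /(_ 1 ltr01)[r r0 hr]].
exists r, (1 + modulus d); split=> //; first by rewrite addr_ge0// modulus_ge0.
move=> w /hr h; rewrite -[f w - f p](subrK (d * (w - p))).
by rewrite (le_trans (modulusD _ _))// modulusM mulrDl lerD.
Qed.

Section frame.
Variables (x0 x1 y0 y1 : R) (a : C).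
Hypothesis ax : x0 < complex.Re a < x1.
Hypothesis ay : y0 < complex.Im a < y1.

Lemma frame_dist : exists2 m : R, 0 < m & forall z, on_frame x0 x1 y0 y1 z ->
  m <= modulus (z - a).
Proof.
move: ax ay => /andP[ax0 ax1] /andP[ay0 ay1].
exists (Num.min (Num.min (complex.Re a - x0) (x1 - complex.Re a))
  (Num.min (complex.Im a - y0) (y1 - complex.Im a))).
  by rewrite !lt_min !subr_gt0 ax0 ax1 ay0 ay1.
move=> z [[/andP[zx0 zx1] /andP[zy0 zy1]] zf]; rewrite !ge_min.
have hx : `|complex.Re z - complex.Re a| <= modulus (z - a).
  by apply: le_trans (normRe_modulus _); case: (z) (a) => ? ? [].
have hy : `|complex.Im z - complex.Im a| <= modulus (z - a).
  by apply: le_trans (normIm_modulus _); case: (z) (a) => ? ? [].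
case: zf => ze; rewrite ze in hx hy.
- have -> // : complex.Re a - x0 <= modulus (z - a).
  by apply: le_trans hx; rewrite distrC ler_norm.
- have -> : x1 - complex.Re a <= modulus (z - a) by apply: le_trans hx; exact: ler_norm.
  by rewrite !orbT.
- have -> : complex.Im a - y0 <= modulus (z - a).
    by apply: le_trans hy; rewrite distrC ler_norm.
  by rewrite !orbT.
- have -> : y1 - complex.Im a <= modulus (z - a) by apply: le_trans hy; exact: ler_norm.
  by rewrite !orbT.
Qed.

Lemma frame_neq z : on_frame x0 x1 y0 y1 z -> z - a != 0.
Proof. by have [m m0 hm] := frame_dist => /hm h; rewrite -modulus_gt0 (lt_le_trans m0 h). Qed.

Lemma continuous_inv_sub : continuous_on_frame (fun w => (w - a)^-1) x0 x1 y0 y1.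
Proof.
move=> z /frame_neq za; apply: (@cdiff_continuous _ (fun w : C => (w - a)^-1)).
exact: (differentiableV (cdiffB (cdiff_id z) (cdiff_cst a z)) za).
Qed.

(** The imaginary part of [dz / (z - a)] is the increment of the argument of
   [z - a], positive along each of the four edges; on the right edge it is bounded
   below by an explicit positive constant. *)
Lemma frame_integral_inv : frame_integral (fun w => (w - a)^-1) x0 x1 y0 y1 != 0.
Proof.
move: (ax) (ay) => /andP[ax0 ax1] /andP[ay0 ay1].
have x01 : x0 <= x1 by rewrite ltW// (lt_trans ax0).
have y01' : y0 < y1 by rewrite (lt_trans ay0).
have y01 := ltW y01'.
have [c1 c2 c3 c4] := frame_edges x01 y01 continuous_inv_sub.
have cc k u v : continuous_on u v (cst k : R -> R) by move=> ? _; exact: cvg_cst.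
have Inv u v : (u +i* v : C)^-1 = (u / (u ^+ 2 + v ^+ 2)) +i* (- v / (u ^+ 2 + v ^+ 2)).
  by rewrite mulNr.
pose k : R := (x1 - complex.Re a) / ((x1 - complex.Re a) ^+ 2 + (y1 - y0) ^+ 2).
have k0 : 0 < k.
  rewrite divr_gt0 ?subr_gt0// ltr_pwDl ?sqr_ge0// exprn_gt0 ?subr_gt0//.
have i2 : k * (y1 - y0) <= complex.Re (itv_cintegral (fun y => (x1 +i* y - a)^-1) y0 y1).
  rewrite -(itv_integral_cst k y01).
  apply: (le_itv_integral (cc _ _ _) (continuous_on_Re c2)) => y.
  move=> /andP[yy0 yy1]; rewrite /k; case: (a) ax1 ay0 ay1 => a1 a2 /= ax1 ay0 ay1.
  rewrite ler_pM2l ?subr_gt0// lef_pV2 ?posrE ?ltr_pwDl ?sqr_ge0// ?exprn_gt0 ?subr_gt0//.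
  rewrite lerD2l -real_normK ?num_real// ler_pXn2r// ?nnegrE ?subr_ge0//.
  by rewrite ler_norml; apply/andP; split; lra.
have i1 : 0 <= complex.Im (itv_cintegral (fun x => (x +i* y0 - a)^-1) x0 x1).
  rewrite -[X in X <= _](mul0r (x1 - x0)) -(itv_integral_cst 0 x01).
  apply: (le_itv_integral (cc _ _ _) (continuous_on_Im c1)) => x _; case: (a) ay0 => a1 a2 /= ay0.
  by rewrite -mulNr divr_ge0 ?addr_ge0 ?sqr_ge0//; lra.
have i3 : complex.Im (itv_cintegral (fun x => (x +i* y1 - a)^-1) x0 x1) <= 0.
  rewrite -[X in _ <= X](mul0r (x1 - x0)) -(itv_integral_cst 0 x01).
  apply: (le_itv_integral (continuous_on_Im c3) (cc _ _ _)) => x _; case: (a) ay1 => a1 a2 /= ay1.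
  rewrite oppr_le0 divr_ge0 //; last by rewrite addr_ge0 ?sqr_ge0.
  by rewrite subr_ge0 ltW.
have i4 : complex.Re (itv_cintegral (fun y => (x0 +i* y - a)^-1) y0 y1) <= 0.
  rewrite -[X in _ <= X](mul0r (y1 - y0)) -(itv_integral_cst 0 y01).
  apply: (le_itv_integral (continuous_on_Re c4) (cc _ _ _)) => y _; case: (a) ax0 => a1 a2 /= ax0.
  by rewrite mulr_le0_ge0 ?invr_ge0 ?addr_ge0 ?sqr_ge0//; lra.
have i20 : 0 < k * (y1 - y0) by rewrite mulr_gt0// subr_gt0.
apply/negP => /eqP/(congr1 (@complex.Im R)); rewrite /frame_integral.
move: i1 i2 i3 i4 i20.
case: (itv_cintegral _ _ _) => u1 v1; case: (itv_cintegral _ _ _) => u2 v2.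
case: (itv_cintegral _ _ _) => u3 v3; case: (itv_cintegral _ _ _) => u4 v4 /=.
clear; lra.
Qed.

End frame.

End FrameKernel.

Section MaximumPrinciple.
Context {R : realType}.
Local Notation C := (Cplx R).
Implicit Types (f g h K : C -> C) (z w a p : C).

Section frame.
Variables (x0 x1 y0 y1 : R) (a p : C).
Hypothesis ax : x0 < complex.Re a < x1.
Hypothesis ay : y0 < complex.Im a < y1.
Hypothesis ap : a != p.

Let x01 : x0 <= x1. Proof. by move: ax => /andP[/lt_trans h /h /ltW]. Qed.
Let y01 : y0 <= y1. Proof. by move: ay => /andP[/lt_trans h /h /ltW]. Qed.

(** The Cauchy kernel at [a], multiplied by a factor that vanishes to second order
   at the exceptional point [p]. *)
Definition kernel w : C := (w - p) ^+ 2 / (w - a).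

Lemma continuous_kernel : continuous_on_frame kernel x0 x1 y0 y1.
Proof.
move=> z /(frame_neq ax ay) za; apply: (@cdiff_continuous _ kernel).
exact: (cdiff_div (cdiffX 2 (cdiffB (cdiff_id z) (cdiff_cst p z)))
  (cdiffB (cdiff_id z) (cdiff_cst a z)) za).
Qed.

(** Modulo an affine function, the kernel is [(a - p)^2 / (z - a)]. *)
Lemma frame_integral_kernel : frame_integral kernel x0 x1 y0 y1 != 0.
Proof.
have kE z : on_frame x0 x1 y0 y1 z ->
    kernel z = ((a - p *+ 2) + 1 * z) + (a - p) ^+ 2 * (z - a)^-1.
  move=> /(frame_neq ax ay) za; rewrite /kernel; apply: (mulIf za).
  rewrite divfK// mulrDl -mulrA mulVf//; ring.
rewrite (eq_frame_integral x01 y01 kE).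
have cI := continuous_inv_sub ax ay.
have cA : continuous_on_frame (fun z => (a - p *+ 2) + 1 * z) x0 x1 y0 y1.
  by move=> z _; exact: (cdiff_continuous (cdiff_affine _ _ _)).
have cZ : continuous_on_frame (fun z => (a - p) ^+ 2 * (z - a)^-1) x0 x1 y0 y1.
  by move=> z /cI h; exact: (cvgM (cvg_cst ((a - p) ^+ 2)) h).
rewrite (frame_integralD x01 y01 cA cZ) frame_integral_affine// add0r.
rewrite (frame_integralZ _ x01 y01 cI) mulf_neq0//.
  by rewrite expf_neq0// subr_eq0.
exact: frame_integral_inv.
Qed.

Lemma kernel_bound : exists2 B : R, 0 <= B &
  forall z, on_frame x0 x1 y0 y1 z -> modulus (kernel z) <= B.
Proof.
have [m m0 hm] := frame_dist ax ay.
pose D : R := (x1 - x0) + (y1 - y0) + modulus (a - p).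
have D0 : 0 <= D by apply: (addr_ge0 (addr_ge0 _ _) (modulus_ge0 _)); rewrite subr_ge0.
exists (D ^+ 2 / m); first by rewrite divr_ge0 ?exprn_ge0// ltW.
move=> z zf; rewrite /kernel modulusM modulusV modulusX.
apply: ler_pM; rewrite ?exprn_ge0 ?invr_ge0 ?modulus_ge0//; last first.
  by rewrite lef_pV2 ?posrE ?hm// (lt_le_trans m0)// hm.
rewrite lerXn2r ?nnegrE ?modulus_ge0//.
have -> : z - p = (z - a) + (a - p) by ring.
apply: (le_trans (modulusD _ _)); rewrite lerD2r.
apply: (le_trans (modulus_le_ReIm _)).
case: zf => -[/andP[zx0 zx1] /andP[zy0 zy1]] _.
move: ax ay => /andP[ax0 ax1] /andP[ay0 ay1].
move: zx0 zx1 zy0 zy1 ax0 ax1 ay0 ay1; case: (z) (a) => z1 z2 [a1 a2] /=.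
by move=> *; rewrite lerD// ler_norml; apply/andP; split; lra.
Qed.

(** If [q < 1], integrate [kernel * (g ^ n - 1) ^ 3].  The cube vanishes to third
   order at [a], enough to cancel the pole, so the integrand is differentiable in the
   whole rectangle and integrates to zero.  On the frame it differs from [- kernel] by
   [O(q ^ n)], so the integral of [kernel] would be zero. *)
Lemma frame_maximum_principle_unit g (q B r : R) : g a = 1 ->
  (forall z, in_rect x0 x1 y0 y1 z -> z != p -> differentiable g z) ->
  0 < r -> (forall w, modulus (w - p) < r -> modulus (g w) <= B) ->
  (forall z, on_frame x0 x1 y0 y1 z -> modulus (g z) <= q) -> 1 <= q.
Proof.
move=> ga dg r0 gB gq; rewrite leNgt; apply/negP => q1.
have q0 : 0 <= q.
  apply: (le_trans (modulus_ge0 _) (gq (x0 +i* y0) _)).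
  by split; [split; rewrite /= lexx ?x01 ?y01|apply: Or41].
pose G n w : C := kernel w * (g w ^+ n - 1) ^+ 3.
have dG n z : in_rect x0 x1 y0 y1 z -> differentiable (G n) z.
  move=> zr; have [->{z zr}|zp] := eqVneq z p.
    have ap0 : 0 < modulus (a - p) by rewrite modulus_gt0 subr_eq0.
    (* Near [p] the pole at [a] is at distance at least [|a - p| / 2]. *)
    pose b := 2 / modulus (a - p) * (`|B| ^+ n + 1) ^+ 3.
    apply: (@differentiable_quadratic _ _ _ (Num.min r (modulus (a - p) / 2)) b).
      by rewrite lt_min r0 divr_gt0.
    move=> w; rewrite lt_min => /andP[wr wa]; rewrite /G /kernel.
    rewrite 2!modulusM !modulusX modulusV mulrAC -mulrA mulrC.
    rewrite ler_wpM2r ?sqr_ge0// /b mulrC.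
    have wa' : modulus (a - p) / 2 <= modulus (w - a).
      have := modulusD (a - w) (w - p); rewrite subrKA (modulus_distC a w).
      by move: (modulus (a - p)) (modulus (w - a)) (modulus (w - p)) wa => *; lra.
    apply: ler_pM; rewrite ?invr_ge0 ?exprn_ge0 ?modulus_ge0//.
      have ap2 : 0 < modulus (a - p) / 2 by rewrite divr_gt0.
      by rewrite -invf_div lef_pV2 ?posrE// (lt_le_trans ap2).
    rewrite lerXn2r ?nnegrE ?modulus_ge0 ?addr_ge0 ?exprn_ge0//.
    rewrite (le_trans (modulusB _ _))// modulus1 lerD2r modulusX.
    rewrite lerXn2r ?nnegrE ?modulus_ge0//.
    exact: (le_trans (gB _ wr) (ler_norm _)).
  have dgz := dg z zr zp.
  have dk : differentiable (fun w => g w ^+ n - 1) z.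
    exact: (cdiffB (cdiffX n dgz) (cdiff_cst 1 z)).
  have [za|za] := eqVneq z a; last first.
    apply: (cdiffM _ (cdiffX 3 dk)).
    apply: (cdiff_div (cdiffX 2 (cdiffB (cdiff_id z) (cdiff_cst p z)))
      (cdiffB (cdiff_id z) (cdiff_cst a z))).
    by rewrite subr_eq0.
  move: dk; rewrite {zr zp dgz}za {z}.
  move=> /differentiable_lipschitz[s [c [s0 c0 hs]]].
  apply: (@differentiable_quadratic _ _ _ (Num.min s 1) ((modulus (a - p) + 1) ^+ 2 * c ^+ 3)).
    by rewrite lt_min s0 ltr01.
  move=> w; rewrite lt_min => /andP[ws w1]; rewrite /G /kernel.
  have [->|wa] := eqVneq w a.
    by rewrite subrr invr0 mulr0 mul0r modulus0 !mulr_ge0 ?exprn_ge0 ?addr_ge0 ?modulus_ge0.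
  have wa0 : 0 < modulus (w - a) by rewrite modulus_gt0 subr_eq0.
  rewrite 2!modulusM !modulusX modulusV.
  rewrite -(mulrA (modulus (w - p) ^+ 2)) -[X in _ <= X]mulrA.
  apply: ler_pM; rewrite ?mulr_ge0 ?invr_ge0 ?exprn_ge0 ?modulus_ge0//.
    rewrite lerXn2r ?nnegrE ?modulus_ge0 ?addr_ge0 ?modulus_ge0//.
    have -> : w - p = (a - p) + (w - a) by ring.
    by rewrite (le_trans (modulusD _ _))// lerD2l ltW.
  rewrite mulrC ler_pdivrMr// -(mulrA (c ^+ 3)) -exprSr -exprMn.
  rewrite lerXn2r ?nnegrE ?modulus_ge0 ?mulr_ge0 ?modulus_ge0//.
  by have := hs w ws; rewrite ga expr1n subrr subr0.
have cG n : continuous_on_frame (G n) x0 x1 y0 y1.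
  by apply: differentiable_frame => z /dG.
have JE n : frame_integral kernel x0 x1 y0 y1 =
    frame_integral (fun w => G n w + kernel w) x0 x1 y0 y1.
  rewrite (frame_integralD x01 y01 (cG n) continuous_kernel).
  by rewrite (goursat x01 y01 (dG n)) add0r.
have [Bk Bk0 hBk] := kernel_bound.
pose S : R := (x1 - x0) + (y1 - y0).
have S0 : 0 <= S by apply: addr_ge0; rewrite subr_ge0.
pose c : R := 4 * (Bk * 7) * S.
have Jn n : modulus (frame_integral kernel x0 x1 y0 y1) <= c * q ^+ n.
  rewrite (JE n); have -> : c * q ^+ n = 4 * (Bk * 7 * q ^+ n) * S by rewrite /c; ring.
  apply: frame_integral_bound => //.
    by move=> z zf; exact: (cvgD (cG n z zf) (continuous_kernel zf)).
  move=> z zf; rewrite /G.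
  have -> : kernel z * (g z ^+ n - 1) ^+ 3 + kernel z =
     kernel z * (g z ^+ n * (g z ^+ n * g z ^+ n - 3 * g z ^+ n + 3)) by ring.
  rewrite modulusM -mulrA; apply: ler_pM; rewrite ?modulus_ge0 ?hBk//.
  rewrite modulusM mulrC; have gn : modulus (g z ^+ n) <= q ^+ n.
    by rewrite modulusX lerXn2r ?nnegrE ?modulus_ge0// gq.
  have gn1 : modulus (g z ^+ n) <= 1 by apply: (le_trans gn); rewrite exprn_ile1// ltW.
  apply: ler_pM; rewrite ?modulus_ge0//.
  move: (g z ^+ n) gn1 => u u1.
  have u0 := modulus_ge0 u.
  have m3 : modulus (3 : C) = 3 by rewrite -[3](rmorph_nat (real_complex R)) modulusC ger0_norm.
  apply: (le_trans (modulusD _ _)); rewrite m3.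
  have : modulus (u * u - 3 * u) <= 4.
    apply: (le_trans (modulusB _ _)); rewrite !modulusM m3; nra.
  by lra.
have J0 : 0 < modulus (frame_integral kernel x0 x1 y0 y1).
  by rewrite modulus_gt0 frame_integral_kernel.
have /cvgrPdist_lt/(_ _ J0) : c * q ^+ n @[n --> \oo] --> (0 : R).
  rewrite -(mulr0 c); apply: cvgMl_tmp.
  by apply: cvg_expr; rewrite ger0_norm.
case=> n _ /(_ n (leqnn n)); rewrite sub0r normrN => h.
by have := lt_le_trans (le_lt_trans (ler_norm _) h) (Jn n); rewrite ltxx.
Qed.

Lemma frame_maximum_principle h (q B r : R) :
  (forall z, in_rect x0 x1 y0 y1 z -> z != p -> differentiable h z) ->
  0 < r -> (forall w, modulus (w - p) < r -> modulus (h w) <= B) ->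
  (forall z, on_frame x0 x1 y0 y1 z -> modulus (h z) <= q) -> modulus (h a) <= q.
Proof.
move=> dh r0 hB hq.
have q0 : 0 <= q.
  apply: (le_trans (modulus_ge0 _) (hq (x0 +i* y0) _)).
  by split; [split; rewrite /= lexx ?x01 ?y01|apply: Or41].
have [->|ha] := eqVneq (h a) 0; first by rewrite modulus0.
have ha0 : 0 < modulus (h a) by rewrite modulus_gt0.
have := @frame_maximum_principle_unit (fun w => h w / h a) (q / modulus (h a))
  (B / modulus (h a)) r.
rewrite ler_pdivlMr// mul1r; apply=> //.
- by rewrite mulfV.
- move=> z zr zp; exact: (cdiffM (dh z zr zp) (cdiff_cst _ z)).
- by move=> w wr; rewrite modulusM modulusV ler_wpM2r ?invr_ge0 ?modulus_ge0// hB.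
- by move=> w wr; rewrite modulusM modulusV ler_wpM2r ?invr_ge0 ?modulus_ge0// hq.
Qed.

End frame.
End MaximumPrinciple.

(** * The Schwarz lemma in a half-plane and in the disk *)

Section HalfPlane.
Context {R : realType}.
Local Notation C := (Cplx R).
Implicit Types (G : C -> C) (z w a : C).

(** Squaring, the claim follows from [2 x <= e ((x - 1)^2 + y^2)] for [z = x + i y].
   On the left edge [x] is small; on the other edges the right-hand side grows
   quadratically in [L]. *)
Lemma cayley_frame_bound (e L s : R) z : 0 < e -> 2 <= L -> 8 <= e * L ->
  0 < s -> s <= 1 / 2 -> 8 * s <= e -> on_frame s L (- L) L z ->
  modulus (z + 1) <= (1 + e) * modulus (z - 1).
Proof.
move=> e0 L2 eL s0 s2 es zf.
rewrite -(ler_pXn2r (ltn0Sn 1)) ?nnegrE ?mulr_ge0 ?modulus_ge0 ?addr_ge0 ?(ltW e0)//.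
rewrite exprMn !sqr_modulus.
have key : 2 * complex.Re z <= e * ((complex.Re z - 1) ^+ 2 + complex.Im z ^+ 2).
  case: zf => -[/andP[x0 x1] _]; move: x0 x1; case: z => x y /= x0 x1.
  have eLL : 8 * L <= e * L ^+ 2 by rewrite expr2 mulrA ler_wpM2r//; lra.
  have LL : L ^+ 2 / 4 <= (L - 1) ^+ 2 by nra.
  have big t : 0 <= t -> (L - 1) ^+ 2 <= t -> 2 * x <= e * t.
    by move=> t0 h; have := ler_wpM2l (ltW e0) (le_trans LL h); lra.
  have := sqr_ge0 y; have := sqr_ge0 (x - 1) => xx yy [xE|xE|yE|yE].
  - rewrite xE; have : 1 / 4 <= (s - 1) ^+ 2 + y ^+ 2 by nra.
    by move=> /(ler_wpM2l (ltW e0)); lra.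
  - by apply: big; [rewrite addr_ge0|rewrite -xE lerDl].
  - by apply: big; [rewrite addr_ge0|rewrite yE sqrrN; nra].
  - by apply: big; [rewrite addr_ge0|rewrite yE; nra].
move: key; case: z {zf} => x y /=; rewrite oppr0 !addr0 => key.
have := sqr_ge0 y; have := sqr_ge0 (x - 1) => xx yy.
have -> : (x + 1) ^+ 2 + y ^+ 2 = ((x - 1) ^+ 2 + y ^+ 2) + 2 * (2 * x) by ring.
have : 0 <= (x - 1) ^+ 2 + y ^+ 2 by rewrite addr_ge0.
move: ((x - 1) ^+ 2 + y ^+ 2) key => t key t0.
have -> : (1 + e) ^+ 2 * t = t + 2 * (e * t) + e ^+ 2 * t by ring.
have : 0 <= e ^+ 2 * t by rewrite mulr_ge0 ?sqr_ge0.
lra.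
Qed.

(** The maximum principle for [G w (w + 1) / (w - 1)], with exceptional point [1],
   where [G] vanishes.  The bound on the frames is [1 + e], for every [e]. *)
Theorem half_plane_schwarz G :
  (forall w, 0 < complex.Re w -> differentiable G w) ->
  (forall w, 0 < complex.Re w -> modulus (G w) <= 1) ->
  G 1 = 0 ->
  forall a, 0 < complex.Re a -> modulus (G a) * modulus (a + 1) <= modulus (a - 1).
Proof.
move=> dG G1 G0 a a0.
have [->|a1] := eqVneq a 1; first by rewrite G0 modulus0 mul0r modulus_ge0.
have a10 : a - 1 != 0 by rewrite subr_eq0.
have m0 : 0 < modulus (a - 1) by rewrite modulus_gt0.
rewrite -[leRHS]mul1r -ler_pdivrMr// -modulusV -!modulusM.
pose h w := G w * (w + 1) / (w - 1).
rewrite -/(h a).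
suff main : forall e : R, 0 < e -> modulus (h a) <= 1 + e by apply/ler_addgt0Pr.
move=> e e0.
pose L : R := 2 + 8 / e + complex.Re a + `|complex.Im a|.
pose s : R := Num.min (complex.Re a / 2) (Num.min (1 / 2) (e / 8)).
have ime := normr_ge0 (complex.Im a).
have e8 : 0 < 8 / e by rewrite divr_gt0.
have L2 : 2 <= L by rewrite /L; lra.
have eL : 8 <= e * L.
  have -> : 8 = e * (8 / e) :> R by field; rewrite gt_eqF.
  by rewrite ler_pM2l// /L; lra.
have s0 : 0 < s by rewrite !lt_min; lra.
have sa : s <= complex.Re a / 2 by rewrite ge_min lexx.
have s2 : s <= 1 / 2 by rewrite !ge_min lexx orbT.
have se : 8 * s <= e.
  have : s <= e / 8 by rewrite !ge_min lexx !orbT.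
  lra.
have dG1 : differentiable G (1 : C) by apply: dG; rewrite /= ltr01.
have [r [c [r0 c0 hr]]] := differentiable_lipschitz dG1.
have r1 : 0 < Num.min r 1 by rewrite lt_min r0 ltr01.
apply: (@frame_maximum_principle _ s L (- L) L a 1 _ _ a1 h _ (c * 3) _ _ r1).
- by rewrite /L; apply/andP; split; lra.
- have : `|complex.Im a| < L by rewrite /L; lra.
  by rewrite ltr_norml.
- move=> z [/andP[zs _] _] z1.
  have z0 : z - 1 != 0 by rewrite subr_eq0.
  have dGz : differentiable G z by apply: dG; exact: lt_le_trans zs.
  exact: (cdiff_div (cdiffM dGz (cdiffD (cdiff_id z) (cdiff_cst 1 z)))
    (cdiffB (cdiff_id z) (cdiff_cst 1 z)) z0).
- move=> w; rewrite lt_min => /andP[wr w1]; rewrite /h.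
  have [->|wn1] := eqVneq w 1.
    by rewrite subrr invr0 mulr0 modulus0 mulr_ge0.
  have w0 : 0 < modulus (w - 1) by rewrite modulus_gt0 subr_eq0.
  rewrite 2!modulusM modulusV ler_pdivrMr// mulrAC.
  apply: ler_pM; rewrite ?modulus_ge0//.
    by have := hr w wr; rewrite G0 subr0.
  have -> : w + 1 = (w - 1) + 2 by ring.
  apply: (le_trans (modulusD _ _)).
  have -> : modulus (2 : C) = 2.
    by rewrite -[2](rmorph_nat (real_complex R)) modulusC ger0_norm.
  by lra.
- move=> z zf.
  have z1 : 0 < modulus (z - 1).
    rewrite modulus_gt0 subr_eq0; apply/eqP => z1.
    have := cayley_frame_bound e0 L2 eL s0 s2 se zf.
    rewrite z1 subrr modulus0 mulr0 leNgt.
    rewrite modulus_gt0 -(natrD _ 1 1) pnatr_eq0//.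
  rewrite /h 2!modulusM modulusV ler_pdivrMr//.
  have := cayley_frame_bound e0 L2 eL s0 s2 se zf.
  apply: le_trans; rewrite ler_piMl ?modulus_ge0// G1//.
  by case: zf => -[/andP[zs _] _] _; exact: lt_le_trans zs.
Qed.

End HalfPlane.

Section SchwarzPick.
Context {R : realType}.
Local Notation C := (Cplx R).
Implicit Types (f : C -> C) (z w u b x : C).

Lemma cayley_den_neq0 w : 0 < complex.Re w -> w + 1 != 0.
Proof.
by move=> w0; apply/eqP => /(congr1 (@complex.Re R)); case: w w0 => x y /= x0 xE; lra.
Qed.

Lemma cayley_disk w : 0 < complex.Re w -> modulus ((w - 1) / (w + 1)) < 1.
Proof.
move=> w0; have w1 := cayley_den_neq0 w0.
rewrite modulusM modulusV ltr_pdivrMr ?modulus_gt0// mul1r.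
rewrite -(ltr_pXn2r (ltn0Sn 1)) ?nnegrE ?modulus_ge0// !sqr_modulus.
by move: w0; case: (w) => x y /= x0; rewrite oppr0 !addr0 ltrD2r; nra.
Qed.

(** Transport to the half-plane by [w |-> (w - 1) / (w + 1)]. *)
Theorem disk_schwarz f :
  (forall z, disk z -> differentiable f z) ->
  (forall z, disk z -> modulus (f z) <= 1) -> f 0 = 0 ->
  forall z, disk z -> modulus (f z) <= modulus z.
Proof.
move=> df f1 f0 z z1.
pose k w : C := (w - 1) / (w + 1).
have z10 : 1 - z != 0.
  by apply/eqP => /eqP; rewrite subr_eq0 => /eqP zE; move: z1; rewrite /disk/= -zE modulus1 ltxx.
have m10 : 0 < modulus (1 - z) by rewrite modulus_gt0.
have kz : k ((1 + z) / (1 - z)) = z.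
  rewrite /k; have h1 : (1 + z) / (1 - z) + 1 = 2 / (1 - z) by field.
  have h2 : (1 + z) / (1 - z) - 1 = z * (2 / (1 - z)) by field.
  by rewrite h1 h2 mulfK// mulf_neq0 ?invr_eq0// pnatr_eq0.
have Rez : 0 < complex.Re ((1 + z) / (1 - z)).
  have : modulus z ^+ 2 < 1 by rewrite expr_lt1 ?modulus_ge0.
  have : 0 < modulus (1 - z) ^+ 2 by rewrite exprn_gt0.
  rewrite !sqr_modulus; case: (z) => x y /=; rewrite !add0r.
  rewrite -invr_gt0; set N := (_ + _)^-1 => N0 n1.
  have -> : (1 + x) * ((1 - x) * N) - y * - (- y * N) = (1 - (x ^+ 2 + y ^+ 2)) * N by ring.
  by rewrite mulr_gt0// subr_gt0.
have dk w : 0 < complex.Re w -> differentiable k w.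
  move=> w0; have w1 := cayley_den_neq0 w0.
  exact: (cdiff_div (cdiffB (cdiff_id w) (cdiff_cst 1 w))
    (cdiffD (cdiff_id w) (cdiff_cst 1 w)) w1).
have := @half_plane_schwarz R (f \o k) _ _ _ _ Rez.
rewrite /= kz; set v := (1 + z) / (1 - z) in Rez kz *.
have v1 := cayley_den_neq0 Rez.
move=> H; have {H} : modulus (f z) * modulus (v + 1) <= modulus (v - 1).
  apply: H.
  - by move=> w w0; apply: differentiable_comp; [exact: dk|apply: df; exact: cayley_disk].
  - by move=> w w0; apply: f1; exact: cayley_disk.
  - by rewrite /k subrr mul0r.
rewrite -ler_pdivlMr ?modulus_gt0// -modulusV -modulusM.
by rewrite -/(k v) kz.
Qed.

Definition mobius b x : C := (x - b) / (1 - b^* * x).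

Lemma mobius_den_neq0 b x : disk b -> modulus x <= 1 -> 1 - b^* * x != 0.
Proof.
move=> b1 x1; apply/eqP => /eqP; rewrite subr_eq0 => /eqP h.
have := modulus1 (R := R); rewrite {1}h modulusM modulus_conj => e.
by have := ler_pM (modulus_ge0 _) (modulus_ge0 _) (ltW b1) x1; have := b1; rewrite /disk/=;
  have := modulus_ge0 x; have := modulus_ge0 b; nra.
Qed.

(** The identity behind all Schwarz-Pick estimates: divided by the left-hand side,
   it computes [1 - |mobius b x|^2]. *)
Lemma sqr_modulus_den b x : modulus (1 - b^* * x) ^+ 2 =
  modulus (x - b) ^+ 2 + (1 - modulus b ^+ 2) * (1 - modulus x ^+ 2).
Proof. by rewrite !sqr_modulus; case: b x => [b1 b2] [x1 x2] /=; ring. Qed.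

Lemma mobius_le1 b x : disk b -> modulus x <= 1 -> modulus (mobius b x) <= 1.
Proof.
move=> b1 x1; have d0 := mobius_den_neq0 b1 x1.
rewrite modulusM modulusV ler_pdivrMr ?modulus_gt0// mul1r.
rewrite -(ler_pXn2r (ltn0Sn 1)) ?nnegrE ?modulus_ge0// sqr_modulus_den lerDl.
by rewrite mulr_ge0// subr_ge0 expr_le1 ?modulus_ge0// ltW.
Qed.

Lemma mobius_lt1 b x : disk b -> disk x -> disk (mobius b x).
Proof.
move=> b1 x1; have d0 := mobius_den_neq0 b1 (ltW x1).
rewrite /disk/= modulusM modulusV ltr_pdivrMr ?modulus_gt0// mul1r.
rewrite -(ltr_pXn2r (ltn0Sn 1)) ?nnegrE ?modulus_ge0// sqr_modulus_den ltrDl.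
by rewrite mulr_gt0// subr_gt0 expr_lt1 ?modulus_ge0.
Qed.

Lemma differentiable_mobius b x : disk b -> modulus x <= 1 -> differentiable (mobius b) x.
Proof.
move=> b1 x1; exact: (cdiff_div (cdiffB (cdiff_id x) (cdiff_cst b x))
  (cdiffB (cdiff_cst 1 x) (cdiffM (cdiff_cst (b^*) x) (cdiff_id x)))
  (mobius_den_neq0 b1 x1)).
Qed.

Lemma diskN b : disk b -> disk (- b).
Proof. by rewrite /disk/= modulusN. Qed.

Lemma mobiusK b x : disk b -> disk x -> mobius (- b) (mobius b x) = x.
Proof.
move=> b1 x1; have m1 := mobius_lt1 b1 x1.
have d0 := mobius_den_neq0 b1 (ltW x1).
have d1 := mobius_den_neq0 (diskN b1) (ltW m1).
apply: (mulIf d1); rewrite [mobius (- b) _]/mobius divfK//.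
have -> : 1 - (- b)^* * mobius b x = 1 + b^* * mobius b x.
  case: (b) (mobius b x) => [b1' b2] [u1 u2]; apply/eqP; rewrite eq_complex/=.
  by apply/andP; split; apply/eqP; ring.
rewrite /mobius; move: d0; set d := b^*; move=> d0.
by field.
Qed.

Lemma mobius_self b : mobius b b = 0.
Proof. by rewrite /mobius subrr mul0r. Qed.

Lemma mobiusN0 b : mobius (- b) 0 = b.
Proof. by rewrite /mobius mulr0 subr0 divr1 opprK add0r. Qed.

(** An analytic disk through [0] and [(z1, z2)] in the bidisk: with [z] the larger
   of the two, [u |-> (c1 u, c2 u)] sends [z] to [(z1, z2)]. *)
Lemma common_radius z1 z2 : exists z c1 c2 : C,
  [/\ modulus c1 <= 1, modulus c2 <= 1, c1 * z = z1, c2 * z = z2 & (z = z1 \/ z = z2)].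
Proof.
wlog z12 : z1 z2 / modulus z2 <= modulus z1.
  move=> H; have [|/ltW] := leP (modulus z2) (modulus z1); first exact: H.
  by move=> /H[z [c1 [c2 [? ? ? ? zz]]]]; exists z, c2, c1; split=> //; case: zz; [right|left].
exists z1, 1, (z2 / z1).
have [z10|z10] := eqVneq z1 0.
  have -> : z2 = 0.
    apply/eqP; rewrite -modulus_eq0 eq_le modulus_ge0 andbT.
    by rewrite (le_trans z12)// z10 modulus0.
  by rewrite z10 modulus1 mul0r modulus0 !mulr0; split; rewrite ?ler01//; left.
split; rewrite ?modulus1 ?mul1r ?divfK//; last by left.
by rewrite modulusM modulusV ler_pdivrMr ?modulus_gt0// mul1r.
Qed.

Lemma diskM c z : modulus c <= 1 -> disk z -> disk (c * z).
Proof.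
rewrite /disk/= modulusM => c1 z1; apply: le_lt_trans z1.
by rewrite ler_piMl// modulus_ge0.
Qed.

Implicit Types (phi : Cplx2 R -> C) (lambda mu : Cplx2 R).

(** The Schwarz lemma on an analytic disk through [lambda] and [mu], with [phi]
   followed by the Mobius map that sends [phi lambda] to [0]. *)
Lemma schwarz_pick_mobius phi lambda mu : schur2 phi ->
  bidisk lambda -> bidisk mu -> disk (phi lambda) ->
  exists z, [/\ disk z, z = mobius lambda.1 mu.1 \/ z = mobius lambda.2 mu.2 &
    modulus (mobius (phi lambda) (phi mu)) <= modulus z].
Proof.
move=> hphi [l1 l2] [m1 m2] b1.
have [z [c1 [c2 [c11 c21 e1 e2 zz]]]] :=
  common_radius (mobius lambda.1 mu.1) (mobius lambda.2 mu.2).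
have zD : disk z by case: zz => ->; exact: mobius_lt1.
exists z; split=> //.
pose g1 u := mobius (- lambda.1) (c1 * u).
pose g2 u := mobius (- lambda.2) (c2 * u).
pose F u := mobius (phi lambda) (phi (g1 u, g2 u)).
have gD u : disk u -> bidisk (g1 u, g2 u).
  by move=> u1; split; apply: mobius_lt1; (try exact: diskN); exact: diskM.
have -> : mobius (phi lambda) (phi mu) = F z.
  by rewrite /F /g1 /g2 e1 e2 !mobiusK//; case: (mu).
apply: (@disk_schwarz F _ _ _ z zD).
- move=> u u1; have [dphi phi1] := hphi _ (gD u u1).
  apply: (differentiable_comp _ (differentiable_mobius b1 phi1)).
  apply: (differentiable_comp (f := fun u => (g1 u, g2 u)) _ dphi).
  have dM (c : C) : differentiable (fun u => c * u) u.
    exact: (cdiffM (cdiff_cst c u) (cdiff_id u)).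
  apply: differentiable_pair.
    apply: (differentiable_comp (dM c1) (differentiable_mobius (diskN l1) (ltW _))).
    exact: diskM.
  apply: (differentiable_comp (dM c2) (differentiable_mobius (diskN l2) (ltW _))).
  exact: diskM.
- by move=> u u1; have [_ phi1] := hphi _ (gD u u1); exact: mobius_le1.
- by rewrite /F /g1 /g2 !mulr0 !mobiusN0; case: (lambda) => ? ?; exact: mobius_self.
Qed.

(** If [|phi mu| < 1], the point [phi lambda] lies within finite hyperbolic distance of
   [phi mu], so it is inside the disk. *)
Lemma schur_unimodular_point phi lambda mu : schur2 phi ->
  bidisk lambda -> bidisk mu -> modulus (phi lambda) = 1 -> modulus (phi mu) = 1.
Proof.
move=> hphi l1 m1 h1; apply/eqP; rewrite eq_le (hphi mu m1).2/= leNgt; apply/negP => h2.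
have [z [z1 _]] := schwarz_pick_mobius hphi m1 l1 h2.
have d0 := mobius_den_neq0 h2 (hphi _ l1).2.
rewrite leNgt => /negP; apply; apply: (lt_le_trans z1).
rewrite modulusM modulusV ler_pdivlMr ?modulus_gt0// mul1r.
rewrite -(ler_pXn2r (ltn0Sn 1)) ?nnegrE ?modulus_ge0// sqr_modulus_den.
by rewrite h1 expr1n subrr mulr0 addr0.
Qed.

(** Apply [schur_unimodular_point] to the average of [phi] and [phi lambda]: its
   modulus is one everywhere, and the unit circle is strictly convex. *)
Lemma schur_unimodular_constant phi lambda mu : schur2 phi ->
  bidisk lambda -> bidisk mu -> modulus (phi lambda) = 1 -> phi mu = phi lambda.
Proof.
move=> hphi l1 m1 h1; have h2 := schur_unimodular_point hphi l1 m1 h1.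
(* [psi] has modulus one at [lambda], hence everywhere. *)
pose psi nu := 2^-1 * (phi nu + phi lambda).
have m2 : modulus (2^-1 : C) = 2^-1.
  by rewrite modulusV -[2](rmorph_nat (real_complex R)) modulusC ger0_norm.
have hpsi : schur2 psi.
  move=> nu n1; have [dphi phi1] := hphi _ n1; split.
    exact: (differentiableM (differentiable_cst _ _)
      (differentiableD dphi (differentiable_cst _ _))).
  rewrite /psi modulusM m2; have := modulusD (phi nu) (phi lambda); rewrite h1; lra.
have := @schur_unimodular_point psi lambda mu hpsi l1 m1; rewrite /psi.
have -> : 2^-1 * (phi lambda + phi lambda) = phi lambda by field.
move=> /(_ h1); rewrite modulusM m2 => h3.
have h4 : modulus (phi mu + phi lambda) ^+ 2 = 4.
  by rewrite -[modulus _](mulKf (_ : 2^-1 != 0)) ?invr_eq0 ?pnatr_eq0// h3 invrK mulr1; ring.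
apply/eqP; rewrite -subr_eq0 -modulus_eq0 -sqrf_eq0; apply/eqP.
move: h1 h2 h4 => /(congr1 (fun t => t ^+ 2)) + /(congr1 (fun t => t ^+ 2)).
rewrite !sqr_modulus; case: (phi lambda) (phi mu) => [a1 a2] [b1 b2] /=; lra.
Qed.

(** The square of the hyperbolic cosine of half the Poincare distance from [u] to
   [v] (curvature [-1]). *)
Definition hyp_ratio u v : R :=
  modulus (1 - u^* * v) ^+ 2 / ((1 - modulus u ^+ 2) * (1 - modulus v ^+ 2)).

Lemma hyp_ratio_mobius u v : disk u -> disk v ->
  hyp_ratio u v * (1 - modulus (mobius u v) ^+ 2) = 1.
Proof.
move=> u1 v1; have d0 := mobius_den_neq0 u1 (ltW v1).
have d1 : modulus (1 - u^* * v) ^+ 2 != 0 by rewrite sqrf_eq0 modulus_eq0.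
have uu : 1 - modulus u ^+ 2 != 0 by rewrite subr_eq0 eq_sym lt_eqF// expr_lt1 ?modulus_ge0.
have vv : 1 - modulus v ^+ 2 != 0 by rewrite subr_eq0 eq_sym lt_eqF// expr_lt1 ?modulus_ge0.
rewrite /hyp_ratio /mobius modulusM modulusV exprMn exprVn.
have := sqr_modulus_den u v.
move: (modulus (1 - _) ^+ 2) d1 => A A0 AE.
have -> : modulus (v - u) ^+ 2 = A - (1 - modulus u ^+ 2) * (1 - modulus v ^+ 2).
  by rewrite AE addrK.
by field; rewrite A0 uu vv.
Qed.

(** In this form, with all denominators on the side of [phi] cleared, the inequality
   covers unimodular constants as well. *)
Theorem bidisk_schwarz_pick phi lambda mu : schur2 phi ->
  bidisk lambda -> bidisk mu ->
  modulus (1 - (phi lambda)^* * phi mu) ^+ 2 <=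
  (1 - modulus (phi lambda) ^+ 2) * (1 - modulus (phi mu) ^+ 2) *
  Num.max (hyp_ratio lambda.1 mu.1) (hyp_ratio lambda.2 mu.2).
Proof.
move=> hphi lD mD; have [_ pl1] := hphi _ lD; have [_ pm1] := hphi _ mD.
move: (pl1); rewrite le_eqVlt => /predU1P[h|h].
  rewrite (schur_unimodular_constant hphi lD mD h) sqr_modulus_den.
  by rewrite subrr modulus0 h expr1n subrr !mul0r expr0n addr0.
have [z [zD zE hz]] := schwarz_pick_mobius hphi lD mD h.
have d0 := mobius_den_neq0 h pm1.
have pz : 0 < 1 - modulus z ^+ 2 by rewrite subr_gt0 expr_lt1 ?modulus_ge0.
have [S [S0 Sz SM]] : exists S, [/\ 0 <= S, S * (1 - modulus z ^+ 2) = 1 &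
    S <= Num.max (hyp_ratio lambda.1 mu.1) (hyp_ratio lambda.2 mu.2)].
  case: lD mD => l1 l2 [m1 m2]; case: zE => zE.
    exists (hyp_ratio lambda.1 mu.1); rewrite zE hyp_ratio_mobius// le_max lexx; split=> //.
    rewrite divr_ge0 ?sqr_ge0// mulr_ge0// subr_ge0 expr_le1 ?modulus_ge0// ltW//.
  exists (hyp_ratio lambda.2 mu.2); rewrite zE hyp_ratio_mobius// le_max lexx orbT; split=> //.
  rewrite divr_ge0 ?sqr_ge0// mulr_ge0// subr_ge0 expr_le1 ?modulus_ge0// ltW//.
have P0 : 0 <= (1 - modulus (phi lambda) ^+ 2) * (1 - modulus (phi mu) ^+ 2).
  by rewrite mulr_ge0// subr_ge0 expr_le1 ?modulus_ge0.
apply: le_trans (ler_wpM2l P0 SM).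
have {hz}: modulus (phi mu - phi lambda) ^+ 2 <=
    modulus z ^+ 2 * modulus (1 - (phi lambda)^* * phi mu) ^+ 2.
  move: hz; rewrite /mobius modulusM modulusV ler_pdivrMr ?modulus_gt0// => hz.
  by rewrite -exprMn lerXn2r ?nnegrE ?mulr_ge0 ?modulus_ge0.
have := sqr_modulus_den (phi lambda) (phi mu).
move: (modulus (1 - _) ^+ 2) (modulus (phi mu - phi lambda) ^+ 2) P0.
move: ((1 - modulus (phi lambda) ^+ 2) * (1 - modulus (phi mu) ^+ 2)) => P A B P0 AE hB.
have : (1 - modulus z ^+ 2) * A <= P by lra.
by move=> /(ler_wpM2l S0); rewrite mulrA Sz mul1r mulrC.
Qed.

End SchwarzPick.

(** * Julia's lemma on the bidisk *)

Section Julia.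
Context {R : realType}.
Local Notation C := (Cplx R).
Local Notation C2 := (Cplx2 R).
Implicit Types (phi : C2 -> C) (lambda mu tau : C2).

(** Compactness of segments: a cluster point of an ultrafilter is a limit. *)
Lemma ultra_bounded_cvg T (G : set_system T) (f : T -> R) (B : R) :
  UltraFilter G -> (\forall x \near G, `|f x| <= B) -> exists l : R, f x @[x --> G] --> l.
Proof.
move=> UG fB.
have GB : (f @ G) `[- B, B]%classic.
  by near=> x; rewrite /= in_itv/= -ler_norml; near: x.
have [l [_ lc]] := @segment_compact R (- B) B (f @ G) _ GB.
exists l => V Vl; have [//|GV] := in_ultra_setVsetC (f @^-1` V) UG.
by have [y [/= nVy Vy]] := lc (~` V) V GV Vl.
Unshelve. all: by end_near. Qed.

Lemma ultra_disk_cvg T (G : set_system T) (f : T -> C) :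
  UltraFilter G -> (\forall x \near G, modulus (f x) <= 1) ->
  exists l : C, f x @[x --> G] --> l.
Proof.
move=> UG f1.
have [l1 h1] : exists l : R, complex.Re (f x) @[x --> G] --> l.
  by apply: (@ultra_bounded_cvg _ _ _ 1); apply: filterS f1 => x; exact/le_trans/normRe_modulus.
have [l2 h2] : exists l : R, complex.Im (f x) @[x --> G] --> l.
  by apply: (@ultra_bounded_cvg _ _ _ 1); apply: filterS f1 => x; exact/le_trans/normIm_modulus.
by exists (l1 +i* l2); apply/cvg_ReImP.
Qed.

Lemma cvg_max T (F : set_system T) {FF : Filter F} (f g : T -> R) (a b : R) :
  f x @[x --> F] --> a -> g x @[x --> F] --> b ->
  Num.max (f x) (g x) @[x --> F] --> Num.max a b.
Proof.
move=> fa gb; under eq_fun do rewrite maxr_absE; rewrite maxr_absE.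
by apply: cvgMr_tmp; apply: cvgD; [exact: cvgD|apply: cvg_norm; exact: cvgB].
Qed.

Lemma modulus_conjB (z u : C) : modulus ((z^* : C) - u^*) = modulus (z - u).
Proof. by case: z u => a b [c d]; rewrite !modulusE/=; congr (Num.sqrt _); ring. Qed.

Lemma cvg_conj T (F : set_system T) {FF : Filter F} (f : T -> C) (l : C) :
  f x @[x --> F] --> l -> ((f x)^* : C) @[x --> F] --> (l^* : C).
Proof.
move=> /cvg_modulusP h; apply/cvg_modulusP => e /h; apply: filterS => x.
by rewrite modulus_conjB.
Qed.

(** The radius of the horocycle at [t] whose boundary passes through [u]. *)
Definition horocycle_level (u t : C) : R := modulus (u - t) ^+ 2 / (1 - modulus u ^+ 2).

(** Julia's inequality with the denominator [1 - |phi mu|^2] cleared, so that it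
   makes sense for unimodular constants. *)
Definition julia_bound phi tau (w : C) (a1 a2 : R) := forall mu, bidisk mu ->
  modulus (phi mu - w) ^+ 2 <= (1 - modulus (phi mu) ^+ 2) *
    Num.max (a1 * horocycle_level mu.1 tau.1) (a2 * horocycle_level mu.2 tau.2).

Lemma horocycle_level_ge0 (u t : C) : disk u -> 0 <= horocycle_level u t.
Proof.
by move=> u1; rewrite divr_ge0 ?sqr_ge0// subr_ge0 expr_le1 ?modulus_ge0// ltW.
Qed.

Lemma one_sub_sqr_gt0 (u : C) : disk u -> 0 < 1 - modulus u ^+ 2.
Proof. by move=> u1; rewrite subr_gt0 expr_lt1 ?modulus_ge0. Qed.

Lemma modulus_unit_den (w x : C) : circle w -> modulus (1 - w^* * x) = modulus (x - w).
Proof.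
move=> w1; have := sqr_modulus_den w x; rewrite w1 expr1n subrr mul0r addr0.
by move=> /eqP; rewrite eqrXn2 ?modulus_ge0// => /eqP.
Qed.

(** As [g] tends to [t] on the circle, [hyp_ratio g u] blows up like the inverse of
   [1 - |g|^2]; the factor [1 - s^2] compensates. *)
Lemma hyp_ratio_cvg T (F : set_system T) {FF : Filter F} (s : T -> R) (b : R)
    (g : T -> C) (t u : C) :
  circle t -> g x @[x --> F] --> t -> s x @[x --> F] --> (1 : R) ->
  (1 - s x) / (1 - modulus (g x)) @[x --> F] --> b ->
  (1 - s x ^+ 2) * hyp_ratio (g x) u @[x --> F] --> b * horocycle_level u t.
Proof.
move=> t1 gt s1 kb.
have -> : (fun x => (1 - s x ^+ 2) * hyp_ratio (g x) u) =
  (fun x => (1 - s x) / (1 - modulus (g x)) * ((1 + s x) / (1 + modulus (g x)) *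
     (modulus (1 - (g x)^* * u) ^+ 2 / (1 - modulus u ^+ 2)))).
  have E (y : R) : 1 - y ^+ 2 = (1 - y) * (1 + y) by ring.
  by apply/funext => x; rewrite /hyp_ratio !E !invfM; ring.
have mt : modulus (g x) @[x --> F] --> (1 : R).
  by rewrite -(t1 : modulus t = 1); exact: cvg_modulus.
have c1 : (1 + s x) / (1 + modulus (g x)) @[x --> F] --> ((1 + 1) / (1 + 1) : R).
  have n2 : 1 + 1 != 0 :> R by rewrite -(natrD _ 1 1) pnatr_eq0.
  have d1 : 1 + s x @[x --> F] --> (1 + 1 : R) by exact: (cvgD (cvg_cst (1 : R)) s1).
  have d2 : 1 + modulus (g x) @[x --> F] --> (1 + 1 : R).
    by exact: (cvgD (cvg_cst (1 : R)) mt).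
  have d3 : (1 + modulus (g x))^-1 @[x --> F] --> ((1 + 1)^-1 : R) by exact: (cvgV n2 d2).
  by exact: (cvgM d1 d3).
have h : (1 - (g x)^* * u : C) @[x --> F] --> (1 - t^* * u : C).
  exact: (cvgB (cvg_cst (1 : C)) (cvgMr_tmp (cvg_conj gt))).
have h2 : modulus (1 - (g x)^* * u) ^+ 2 @[x --> F] --> modulus (u - t) ^+ 2.
  rewrite -(modulus_unit_den u t1).
  exact: (cvgM (cvg_modulus h) (cvg_modulus h)).
have -> : b * horocycle_level u t = b * ((1 + 1) / (1 + 1) * horocycle_level u t).
  by rewrite divff ?mul1r// -(natrD _ 1 1) pnatr_eq0.
exact: (cvgM kb (cvgM c1 (cvgMr_tmp h2))).
Qed.

(** Pass to the limit in the Schwarz-Pick inequality between [lam x] and [mu].  A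
   general filter is allowed, since limits along ultrafilters are needed. *)
Theorem julia_limit phi tau T (F : set_system T) {FF : ProperFilter F}
    (lam : T -> C2) (w : C) (a1 a2 : R) :
  schur2 phi -> torus tau -> circle w ->
  (\forall x \near F, bidisk (lam x)) ->
  (lam x).1 @[x --> F] --> tau.1 -> (lam x).2 @[x --> F] --> tau.2 ->
  phi (lam x) @[x --> F] --> w ->
  (1 - modulus (phi (lam x))) / (1 - modulus (lam x).1) @[x --> F] --> a1 ->
  (1 - modulus (phi (lam x))) / (1 - modulus (lam x).2) @[x --> F] --> a2 ->
  julia_bound phi tau w a1 a2.
Proof.
move=> hphi [t1 t2] w1 lD l1 l2 pw k1 k2 mu mD.
have [_ pm1] := hphi _ mD.
rewrite -(modulus_unit_den _ w1).
have s1 : modulus (phi (lam x)) @[x --> F] --> (1 : R).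
  by rewrite -(w1 : modulus w = 1); exact: cvg_modulus.
have FF' : Filter F by exact: _.
have c1 := hyp_ratio_cvg (FF := FF') (u := mu.1) t1 l1 s1 k1.
have c2 := hyp_ratio_cvg (FF := FF') (u := mu.2) t2 l2 s1 k2.
have cR := cvg_max (FF := FF') c1 c2.
have h : (1 - (phi (lam x))^* * phi mu : C) @[x --> F] --> (1 - w^* * phi mu : C).
  exact: (cvgB (cvg_cst (1 : C)) (cvgMr_tmp (cvg_conj pw))).
have cL : modulus (1 - (phi (lam x))^* * phi mu) ^+ 2 @[x --> F] -->
    modulus (1 - w^* * phi mu) ^+ 2.
  exact: (cvgM (cvg_modulus h) (cvg_modulus h)).
rewrite -subr_ge0; apply: (cvgr_to_ge (cvgB (cvgMl_tmp (a := 1 - modulus (phi mu) ^+ 2) cR) cL)).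
apply: filterS lD => x lD; rewrite subr_ge0.
have := bidisk_schwarz_pick hphi lD mD.
have [_ pl1] := hphi _ lD.
rewrite [X in X * Num.max _ _]mulrC -mulrA maxr_pMr// subr_ge0.
by rewrite expr_le1 ?modulus_ge0.
Qed.

End Julia.

Section JuliaCluster.
Context {R : realType}.
Local Notation C := (Cplx R).
Local Notation C2 := (Cplx2 R).
Implicit Types (phi : C2 -> C) (lambda mu tau : C2).

Lemma maxmod_lt1 lambda : bidisk lambda -> maxmod lambda < 1.
Proof. by move=> [l1 l2]; rewrite /maxmod gt_max; apply/andP; split. Qed.

Lemma ratio_le_julia_quotient phi lambda (u : C) : schur2 phi -> bidisk lambda ->
  modulus u <= maxmod lambda ->
  0 <= (1 - modulus (phi lambda)) / (1 - modulus u) <= julia_quotient phi lambda.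
Proof.
move=> hphi lD ul; have [_ p1] := hphi _ lD; have m1 := maxmod_lt1 lD.
have u1 : modulus u < 1 := le_lt_trans ul m1.
apply/andP; split; first by rewrite divr_ge0 ?subr_ge0// ltW.
rewrite ler_wpM2l ?subr_ge0// lef_pV2 ?posrE ?subr_gt0//.
by rewrite lerD2l lerN2.
Qed.

(** Julia's lemma when the quotient is only bounded: along a finer ultrafilter both
   ratios and the values of [phi] converge. *)
Lemma julia_cluster phi tau T (F : set_system T) {FF : ProperFilter F}
    (lam : T -> C2) (B : R) :
  schur2 phi -> torus tau -> (\forall x \near F, bidisk (lam x)) ->
  (lam x).1 @[x --> F] --> tau.1 -> (lam x).2 @[x --> F] --> tau.2 ->
  (\forall x \near F, julia_quotient phi (lam x) <= B) ->
  exists (G : set_system T) (w : C) (a1 a2 : R),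
  [/\ ProperFilter G, F `<=` G & circle w] /\
  [/\ 0 <= a1, 0 <= a2,
   (1 - modulus (phi (lam x))) / (1 - modulus (lam x).1) @[x --> G] --> a1,
   (1 - modulus (phi (lam x))) / (1 - modulus (lam x).2) @[x --> G] --> a2 &
   julia_bound phi tau w a1 a2].
Proof.
move=> hphi ht lD l1 l2 qB.
have [G [UG FG]] := ultraFilterLemma FF.
have PG : ProperFilter G by exact: _.
have FG' : Filter G by exact: _.
have {}lD : \forall x \near G, bidisk (lam x) by exact: FG.
have {}qB : \forall x \near G, julia_quotient phi (lam x) <= B by exact: FG.
have {}l1 : (lam x).1 @[x --> G] --> tau.1 by move=> V /l1; exact: FG.
have {}l2 : (lam x).2 @[x --> G] --> tau.2 by move=> V /l2; exact: FG.
pose k1 x := (1 - modulus (phi (lam x))) / (1 - modulus (lam x).1).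
pose k2 x := (1 - modulus (phi (lam x))) / (1 - modulus (lam x).2).
have b1 : \forall x \near G, 0 <= k1 x <= B.
  apply: filterS2 lD qB => x lD qB.
  have ul : modulus (lam x).1 <= maxmod (lam x) by rewrite le_max lexx.
  have /andP[h1 h2] := ratio_le_julia_quotient hphi lD ul.
  by rewrite h1 (le_trans h2).
have b2 : \forall x \near G, 0 <= k2 x <= B.
  apply: filterS2 lD qB => x lD qB.
  have ul : modulus (lam x).2 <= maxmod (lam x) by rewrite le_max lexx orbT.
  have /andP[h1 h2] := ratio_le_julia_quotient hphi lD ul.
  by rewrite h1 (le_trans h2).
have [a1 ka1] : exists a1 : R, k1 x @[x --> G] --> a1.
  by apply: (@ultra_bounded_cvg _ _ _ _ B); apply: filterS b1 => x /andP[? ?]; rewrite ger0_norm.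
have [a2 ka2] : exists a2 : R, k2 x @[x --> G] --> a2.
  by apply: (@ultra_bounded_cvg _ _ _ _ B); apply: filterS b2 => x /andP[? ?]; rewrite ger0_norm.
have [w pw] : exists w : C, phi (lam x) @[x --> G] --> w.
  by apply: ultra_disk_cvg; apply: filterS lD => x /hphi[].
have w1 : circle w.
  have h1 : modulus (lam x).1 @[x --> G] --> (1 : R).
    by rewrite -(ht.1 : modulus tau.1 = 1); exact: cvg_modulus.
  have h2 : 1 - k1 x * (1 - modulus (lam x).1) @[x --> G] --> (1 - a1 * (1 - 1) : R).
    exact: (cvgB (cvg_cst (1 : R)) (cvgM ka1 (cvgB (cvg_cst (1 : R)) h1))).
  rewrite subrr mulr0 subr0 in h2.
  have h3 := cvg_modulus (FF := FG') pw.
  have h4 : modulus (phi (lam x)) @[x --> G] --> (1 : R).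
    apply: cvg_trans h2; apply: near_eq_cvg; apply: filterS lD => x [x1 _].
    by rewrite /k1 divfK ?subKr// subr_eq0 eq_sym lt_eqF.
  exact: (cvg_unique _ h3 h4).
exists G, w, a1, a2; split=> //; split=> //.
- by apply: (cvgr_to_ge ka1); apply: filterS b1 => x /andP[].
- by apply: (cvgr_to_ge ka2); apply: filterS b2 => x /andP[].
- exact: (julia_limit hphi ht w1 lD l1 l2 pw ka1 ka2).
Qed.

(** Nontangential approach bounds the level by the distance to [t], so the level
   tends to zero. *)
Lemma horocycle_level_nontangential (u t : C) (l c : R) : disk u -> modulus u <= l -> l < 1 ->
  modulus (t - u) <= c * (1 - l) -> horocycle_level u t <= c * modulus (t - u).
Proof.
move=> u1 ul l1 h; rewrite /horocycle_level ler_pdivrMr ?one_sub_sqr_gt0//.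
rewrite modulus_distC expr2 mulrC.
rewrite [leRHS]mulrAC ler_wpM2r ?modulus_ge0//.
apply: (le_trans h).
have c0 : 0 <= c by rewrite -(pmulr_lge0 _ (_ : 0 < 1 - l)) ?subr_gt0// (le_trans _ h) ?modulus_ge0.
rewrite ler_wpM2l//; have := modulus_ge0 u; move: ul u1; rewrite /disk/=; nra.
Qed.

Lemma julia_bound_boundary_value phi tau (w : C) (a1 a2 : R) : schur2 phi ->
  0 <= a1 -> 0 <= a2 -> julia_bound phi tau w a1 a2 -> is_boundary_value phi tau w.
Proof.
move=> hphi a10 a20 jb S [SD _ [c c0 hc]].
apply/cvg_modulusP => e e0.
pose A := (a1 + a2 + 1) * c.
have A0 : 0 < A by rewrite mulr_gt0//; lra.
have r0 : 0 < e ^+ 2 / A by rewrite divr_gt0// exprn_gt0.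
rewrite near_withinE.
have n1 : \forall x \near nbhs tau, modulus (tau.1 - x.1) < e ^+ 2 / A.
  have /cvg_modulusP/(_ _ r0) : (fun x : C2 => x.1) @ nbhs tau --> tau.1 by exact: cvg_fst.
  by [].
have n2 : \forall x \near nbhs tau, modulus (tau.2 - x.2) < e ^+ 2 / A.
  have /cvg_modulusP/(_ _ r0) : (fun x : C2 => x.2) @ nbhs tau --> tau.2 by exact: cvg_snd.
  by [].
apply: filterS2 n1 n2 => x n1 n2 Sx; have xD := SD _ Sx.
have [_ p1] := hphi _ xD.
rewrite modulus_distC -(ltr_pXn2r (ltn0Sn 1)) ?nnegrE ?modulus_ge0 ?(ltW e0)//.
apply: (le_lt_trans (jb _ xD)).
have m1 := maxmod_lt1 xD.
have hx := hc _ Sx; rewrite ge_max in hx; case/andP: hx => hx1 hx2.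
have lv1 : horocycle_level x.1 tau.1 <= c * modulus (tau.1 - x.1).
  by apply: (horocycle_level_nontangential xD.1 _ m1 hx1); rewrite le_max lexx.
have lv2 : horocycle_level x.2 tau.2 <= c * modulus (tau.2 - x.2).
  by apply: (horocycle_level_nontangential xD.2 _ m1 hx2); rewrite le_max lexx orbT.
have h1 := horocycle_level_ge0 tau.1 xD.1; have h2 := horocycle_level_ge0 tau.2 xD.2.
have {}n1 : horocycle_level x.1 tau.1 < c * (e ^+ 2 / A).
  by apply: (le_lt_trans lv1); rewrite ltr_pM2l.
have {}n2 : horocycle_level x.2 tau.2 < c * (e ^+ 2 / A).
  by apply: (le_lt_trans lv2); rewrite ltr_pM2l.
have Ee : (a1 + a2 + 1) * (c * (e ^+ 2 / A)) = e ^+ 2.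
  by rewrite mulrA -/A mulrC divfK// gt_eqF.
have E0 : 0 < c * (e ^+ 2 / A) by rewrite mulr_gt0.
apply: (@le_lt_trans _ _ (Num.max (a1 * horocycle_level x.1 tau.1)
  (a2 * horocycle_level x.2 tau.2))).
  apply: ler_piMl; first by rewrite le_max mulr_ge0.
  by rewrite gerBl sqr_ge0.
rewrite -{}Ee; move: (c * _) (horocycle_level _ _) (horocycle_level _ _) n1 n2 h1 h2 E0.
move=> E x1 x2 n1 n2 h1 h2 E0.
have g1 := ler_wpM2l a10 (ltW n1); have g2 := ler_wpM2l a20 (ltW n2).
have g3 := mulr_ge0 a10 (ltW E0); have g4 := mulr_ge0 a20 (ltW E0).
by rewrite gt_max; apply/andP; split; rewrite !mulrDl mul1r; lra.
Qed.

End JuliaCluster.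

(** * Approach to the boundary along a ray *)

Section Ray.
Context {R : realType}.
Local Notation C := (Cplx R).
Local Notation C2 := (Cplx2 R).
Variables (phi : C2 -> C) (tau : C2) (M : R).
Hypothesis hphi : schur2 phi.
Hypothesis ht : torus tau.
Hypothesis M0 : 0 < M.
Implicit Types (w : C) (t a : R).

Let K : R := Num.max 1 M.
Let k : R := Num.min 1 M.

(** The path on which the directional derivative of the theorem is taken. *)
Definition boundary_ray t : C2 := tau - t%:C *: ((tau.1, tau.2 * M%:C) : C2).

Local Notation ray := boundary_ray.

Lemma ge1_max1 : 1 <= K. Proof. by rewrite le_max lexx. Qed.
Lemma geM_max1 : M <= K. Proof. by rewrite le_max lexx orbT. Qed.
Lemma min1_gt0 : 0 < k. Proof. by rewrite lt_min ltr01. Qed.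

Lemma ray1 t : (ray t).1 = (1 - t)%:C * tau.1.
Proof. by rewrite /boundary_ray/= rmorphB mulrBl mul1r. Qed.

Lemma ray2 t : (ray t).2 = (1 - t * M)%:C * tau.2.
Proof.
rewrite /boundary_ray/= rmorphB rmorphM mulrBl mul1r; congr (_ - _).
by rewrite -[LHS]/(t%:C * (tau.2 * M%:C)) mulrCA mulrC.
Qed.

Definition short_time t := 0 < t /\ K * t < 1.

Lemma short_time_bounds t : short_time t -> [/\ 0 < t, t < 1, 0 < t * M & t * M < 1].
Proof.
move=> [t0 Kt]; split=> //; last 2 first.
- by rewrite mulr_gt0.
- by apply: le_lt_trans Kt; rewrite mulrC ler_wpM2r ?geM_max1// ltW.
- by apply: le_lt_trans Kt; rewrite ler_peMl ?ge1_max1// ltW.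
Qed.

Lemma modulus_ray1 t : short_time t -> modulus (ray t).1 = 1 - t.
Proof.
move=> /short_time_bounds[t0 t1 _ _]; rewrite ray1 modulusM modulusC (ht.1 : modulus _ = 1).
by rewrite mulr1 ger0_norm// subr_ge0 ltW.
Qed.

Lemma modulus_ray2 t : short_time t -> modulus (ray t).2 = 1 - t * M.
Proof.
move=> /short_time_bounds[_ _ t0 t1]; rewrite ray2 modulusM modulusC (ht.2 : modulus _ = 1).
by rewrite mulr1 ger0_norm// subr_ge0 ltW.
Qed.

Lemma ray_bidisk t : short_time t -> bidisk (ray t).
Proof.
move=> st; have [? ? ? ?] := short_time_bounds st; split; rewrite /disk/=.
- by rewrite modulus_ray1// gtrBl.
- by rewrite modulus_ray2// gtrBl.
Qed.

Lemma maxmod_ray t : short_time t -> maxmod (ray t) = 1 - k * t.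
Proof.
move=> st; have [t0 _ _ _] := short_time_bounds st.
rewrite /maxmod modulus_ray1// modulus_ray2// /k minr_pMl ?(ltW t0)// mul1r.
have [tM|Mt] := leP (1 - t) (1 - t * M).
  by rewrite min_r ?(mulrC M)//; lra.
by rewrite min_l ?(mulrC M)//; lra.
Qed.

Lemma near_short_time : \forall t \near 0^'+, short_time t.
Proof.
have K0 : 0 < K := lt_le_trans ltr01 ge1_max1.
near=> t; split; first by near: t; exact: nbhs_right_gt.
rewrite mulrC -ltr_pdivlMr//; near: t; apply: nbhs_right_lt.
by rewrite divr_gt0.
Unshelve. all: by end_near. Qed.

(** At distance [s] from the circle on a radius, the level is [s / 2] to first
   order; this is what makes the constants below sharp. *)
Lemma horocycle_level_radial (s : R) (u : C) : circle u -> 0 < s -> s < 1 ->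
  horocycle_level ((1 - s)%:C * u) u = s / (2 - s).
Proof.
move=> u1 s0 s1; rewrite /horocycle_level modulusM modulusC (u1 : modulus u = 1) mulr1.
have -> : (1 - s)%:C * u - u = - (s%:C * u) :> C.
  by rewrite rmorphB mulrBl mul1r addrC addKr.
rewrite modulusN modulusM modulusC (u1 : modulus u = 1) mulr1.
rewrite ger0_norm ?(ltW s0)// ger0_norm ?subr_ge0 ?(ltW s1)//.
have -> : 1 - (1 - s) ^+ 2 = s * (2 - s) by ring.
by rewrite expr2 -mulf_div divff ?mul1r// gt_eqF.
Qed.

Lemma ray_bound w a t : 0 <= a -> short_time t -> julia_bound phi tau w a (a / M) ->
  modulus (phi (ray t) - w) ^+ 2 <=
  (1 - modulus (phi (ray t)) ^+ 2) * (a * (t / (2 - K * t))).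
Proof.
move=> a0 st jb; have [t0 t1 tM0 tM1] := short_time_bounds st.
have [_ p1] := hphi (ray_bidisk st).
apply: (le_trans (jb _ (ray_bidisk st))).
apply: ler_wpM2l; first by rewrite subr_ge0 expr_le1 ?modulus_ge0.
have [_ Kt] := st.
rewrite ray1 ray2 !horocycle_level_radial//; [|exact: ht.2|exact: ht.1].
have Kt0 : 0 < 2 - K * t by lra.
rewrite ge_max; apply/andP; split.
  apply: ler_wpM2l => //; apply: ler_wpM2l; first exact: ltW.
  rewrite lef_pV2 ?posrE//; last by lra.
  by rewrite lerD2l lerN2 ler_peMl ?ge1_max1// ltW.
have -> : a / M * (t * M / (2 - t * M)) = a * (t / (2 - t * M)).
  by field; rewrite !gt_eqF//; lra.
apply: ler_wpM2l => //; apply: ler_wpM2l; first exact: ltW.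
rewrite lef_pV2 ?posrE//; last by lra.
by rewrite lerD2l lerN2 mulrC ler_wpM2r ?geM_max1// ltW.
Qed.

Definition ray_quotient t : R := (1 - modulus (phi (ray t))) / t.

(** Since [1 - |phi| <= |phi - w|], a factor [1 - |phi|] cancels from
   [ray_bound]. *)
Lemma ray_quotient_le w a t : circle w -> 0 <= a -> short_time t ->
  julia_bound phi tau w a (a / M) -> ray_quotient t <= 2 * a / (2 - K * t).
Proof.
move=> w1 a0 st jb; have := ray_bound a0 st jb; have [t0 Kt] := st.
have [_ p1] := hphi (ray_bidisk st).
have Kt0 : 0 < 2 - K * t by lra.
rewrite /ray_quotient ler_pdivrMr// mulrAC -mulrA.
have := modulusD (phi (ray t)) (w - phi (ray t)); rewrite subrKC (w1 : modulus w = 1).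
rewrite (modulus_distC w).
have : 0 <= a * (t / (2 - K * t)) by rewrite mulr_ge0// divr_ge0// ltW.
rewrite -!mulrA.
move: (a * (t / _)) (modulus (phi _)) (modulus (_ - _)) p1 (modulus_ge0 (phi (ray t))).
move=> X N E p1 N0 X0 EN EX.
have [u0|u0] := lerP (1 - N) 0; first by rewrite (le_trans u0)// mulr_ge0.
have uE : (1 - N) ^+ 2 <= E ^+ 2 by rewrite lerXn2r ?nnegrE; lra.
have : (1 - N) * (1 - N) <= (1 - N) * ((1 + N) * X).
  rewrite -expr2 (le_trans uE)// (le_trans EX)//.
  by rewrite le_eqVlt; apply/orP; left; apply/eqP; ring.
rewrite ler_pM2l// => /le_trans; apply; rewrite ler_wpM2r//; lra.
Qed.

End Ray.

Section RayLimit.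
Context {R : realType}.
Local Notation C := (Cplx R).
Local Notation C2 := (Cplx2 R).
Variables (phi : C2 -> C) (tau : C2) (M : R).
Hypothesis hphi : schur2 phi.
Hypothesis ht : torus tau.
Hypothesis M0 : 0 < M.
Implicit Types (w : C) (t a : R).

Let K : R := Num.max 1 M.
Let k : R := Num.min 1 M.
Local Notation ray := (boundary_ray tau M).
Local Notation short_time := (short_time M).
Local Notation q := (ray_quotient phi tau M).

Lemma cvg_radial (c : R) (u : C) : circle u ->
  ((1 - t * c)%:C * u : C) @[t --> (0 : R)^'+] --> u.
Proof.
move=> u1; apply/cvg_modulusP => e e0; near=> t.
have -> : u - (1 - t * c)%:C * u = (t * c)%:C * u :> C.
  by rewrite rmorphB mulrBl mul1r subKr.
rewrite modulusM modulusC (u1 : modulus u = 1) mulr1 normrM.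
have t0 : 0 < t by near: t; exact: nbhs_right_gt.
rewrite (gtr0_norm t0).
apply: (@le_lt_trans _ _ (t * (`|c| + 1))); first by rewrite ler_pM2l// lerDl.
rewrite -ltr_pdivlMr ?ltr_wpDl//; near: t; apply: nbhs_right_lt.
by rewrite divr_gt0// ltr_wpDl.
Unshelve. all: by end_near. Qed.

Lemma cvg_ray1 : (ray t).1 @[t --> (0 : R)^'+] --> tau.1.
Proof.
under eq_fun do rewrite ray1 -[X in 1 - X]mulr1.
by apply: cvg_radial; case: ht.
Qed.

Lemma cvg_ray2 : (ray t).2 @[t --> (0 : R)^'+] --> tau.2.
Proof. by under eq_fun do rewrite ray2; apply: cvg_radial; case: ht. Qed.

Lemma cvg_ray : ray t @[t --> (0 : R)^'+] --> tau.
Proof.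
have -> : tau = (tau.1, tau.2) by case: (tau).
rewrite (_ : (fun t => _) = (fun t => ((ray t).1, (ray t).2))); last first.
  by apply/funext => t; case: (tau).
exact: cvg_pair cvg_ray1 cvg_ray2.
Qed.

(** On the ray the two gaps [1 - |lambda_i|] are [t] and [t M], so the aperture
   is [max(1, M) / min(1, M)]. *)
Lemma nontangential_ray : nontangential_set tau (ray @` short_time).
Proof.
split.
- by move=> _ [t st <-]; exact: ray_bidisk.
- move=> V Vtau; have h := near_short_time M.
  have h2 : \forall t \near (0 : R)^'+, V (ray t) by exact: cvg_ray.
  have [t [st Vt]] : exists t : R, short_time t /\ V (ray t).
    by apply: (@filter_ex _ (0 : R)^'+); exact: filterI.
  by exists (ray t); split=> //; exists t.
- exists (K / k); first by rewrite divr_gt0 ?(lt_le_trans ltr01 (ge1_max1 M)) ?min1_gt0.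
  move=> _ [t st <-]; rewrite maxmod_ray// [1 - (1 - _)]subKr.
  rewrite -/k mulrA divfK ?gt_eqF ?min1_gt0//.
  have [t0 _] := st.
  have -> : tau - ray t = ((t * 1)%:C * tau.1, (t * M)%:C * tau.2).
    rewrite mulr1 rmorphM -mulrA (mulrC M%:C).
    by rewrite /boundary_ray subKr.
  rewrite /maxmod/= !modulusM !modulusC (ht.1 : modulus _ = 1) (ht.2 : modulus _ = 1) !mulr1.
  rewrite !gtr0_norm ?mulr_gt0// /K maxr_pMl ?(ltW t0)//.
  by rewrite mul1r (mulrC M).
Qed.

Lemma boundary_value_ray w : is_boundary_value phi tau w ->
  phi (ray t) @[t --> (0 : R)^'+] --> w.
Proof.
move=> /(_ _ nontangential_ray) h V Vw.
have hV : nbhs tau (fun x => (ray @` short_time) x -> V (phi x)) by exact: h.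
have h2 := cvg_ray hV.
apply: filterS2 (near_short_time M) h2 => t st; apply.
by exists t.
Qed.

Lemma boundary_value_unique w w' :
  is_boundary_value phi tau w -> is_boundary_value phi tau w' -> w = w'.
Proof. by move=> /boundary_value_ray h /boundary_value_ray; exact: (cvg_unique _ h). Qed.

Lemma ray_julia_quotient t : short_time t -> julia_quotient phi (ray t) = q t / k.
Proof.
move=> st; rewrite /julia_quotient maxmod_ray// [1 - (1 - _)]subKr /ray_quotient.
by rewrite invfM mulrA mulrAC.
Qed.

(** Julia's lemma along the ray: a cluster value [b] of the quotient becomes an
   admissible constant.  The unimodular value is still [w], both being the
   nontangential limit. *)
Lemma ray_cluster w a (F : set_system R) {FF : ProperFilter F} :
  (0 : R)^'+ `<=` F -> circle w -> 0 <= a -> julia_bound phi tau w a (a / M) ->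
  exists (G : set_system R) (b : R), [/\ ProperFilter G, F `<=` G, 0 <= b,
    q t @[t --> G] --> b & julia_bound phi tau w b (b / M)].
Proof.
move=> rF w1 a0 jb.
have k0 := min1_gt0 M0.
have st : \forall t \near F, short_time t by apply: rF; exact: near_short_time.
have jq : \forall t \near F, julia_quotient phi (ray t) <= 2 * a / k.
  apply: filterS st => t st; rewrite ray_julia_quotient// ler_wpM2r ?invr_ge0 ?(ltW k0)//.
  apply: (le_trans (ray_quotient_le hphi ht M0 w1 a0 st jb)).
  have [_ Kt] := st; rewrite ler_piMr ?mulr_ge0// invf_le1; rewrite -/K in Kt *; lra.
have rD : \forall t \near F, bidisk (ray t).
  by apply: filterS st => t st; exact: ray_bidisk.
have [G [w' [b1 [b2 [[PG FG w1'] [b10 b20 kb1 kb2 jb']]]]]] :=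
  julia_cluster hphi ht rD (fun V h => rF _ (cvg_ray1 h)) (fun V h => rF _ (cvg_ray2 h)) jq.
have stG : \forall t \near G, short_time t by exact: FG.
have FG' : Filter G by exact: _.
have qb1 : q t @[t --> G] --> b1.
  apply: cvg_trans kb1; apply: near_eq_cvg; apply: filterS stG => t st'.
  by rewrite modulus_ray1// subKr.
have qb2 : q t / M @[t --> G] --> b2.
  apply: cvg_trans kb2; apply: near_eq_cvg; apply: filterS stG => t st'.
  by rewrite modulus_ray2// subKr invfM mulrA.
have b2E : b2 = b1 / M.
  have h : q t / M @[t --> G] --> b1 / M by apply: cvgMr_tmp; exact: qb1.
  exact: (cvg_unique _ qb2 h).
have ww : w' = w.
  apply: boundary_value_unique.
    exact: (julia_bound_boundary_value hphi b10 b20 jb').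
  by apply: (julia_bound_boundary_value hphi a0 _ jb); rewrite divr_ge0// ltW.
by exists G, b1; split=> //; rewrite -b2E -ww.
Qed.

Lemma cvg_ray_bound a : 2 * a / (2 - K * t) @[t --> (0 : R)^'+] --> a.
Proof.
have n2 : 2 - K * 0 != 0 :> R by rewrite mulr0 subr0 pnatr_eq0.
have t0 : t @[t --> (0 : R)^'+] --> (0 : R) by apply: cvg_at_right_filter; exact: cvg_id.
have d : 2 - K * t @[t --> (0 : R)^'+] --> (2 - K * 0 : R).
  exact: (cvgB (cvg_cst (2 : R)) (cvgMl_tmp t0)).
have {2}-> : a = 2 * a / (2 - K * 0) by rewrite mulr0 subr0; field.
exact: (cvgMl_tmp (cvgV n2 d)).
Qed.

(** Any two cluster values bound each other, by [ray_cluster] and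
   [ray_quotient_le]; hence there is only one. *)
Theorem ray_quotient_cvg w a : circle w -> 0 <= a -> julia_bound phi tau w a (a / M) ->
  exists b : R, [/\ 0 <= b, b <= a, q t @[t --> (0 : R)^'+] --> b &
    julia_bound phi tau w b (b / M)].
Proof.
move=> w1 a0 jb.
have st := near_short_time M.
have [G [b [PG rG b0 qb jb']]] := ray_cluster (fun _ h => h) w1 a0 jb.
have cluster_unique (F : set_system R) (PF : ProperFilter F) (c : R) : (0 : R)^'+ `<=` F ->
    0 <= c -> q t @[t --> F] --> c -> forall c', 0 <= c' -> julia_bound phi tau w c' (c' / M) ->
    c <= c'.
  move=> rF c0 qc c' c0' jc.
  have cb : 2 * c' / (2 - K * t) @[t --> F] --> c'.
    by move=> V /cvg_ray_bound; exact: rF.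
  rewrite -subr_ge0; apply: (cvgr_to_ge (cvgB cb qc)).
  have : \forall t \near F, short_time t by exact: rF.
  by apply: filterS => t stt; rewrite subr_ge0; exact: (ray_quotient_le hphi ht M0 w1 c0' stt jc).
exists b; split=> //; first exact: (cluster_unique G).
apply/cvgrPdist_lt => e e0.
have up : \forall t \near 0^'+, q t < b + e.
  have /cvgrPdist_lt/(_ e e0) := @cvg_ray_bound b.
  apply: filterS2 st => t stt; rewrite ltr_norml => /andP[h _].
  by have := ray_quotient_le hphi ht M0 w1 b0 stt jb'; rewrite -/K; lra.
suff low : \forall t \near 0^'+, b - e < q t.
  by apply: filterS2 up low => t h1 h2; rewrite ltr_norml; apply/andP; split; lra.
apply: contrapT => nlow.
(* If [q] were frequently at most [b - e], this filter would be proper and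
   would yield a smaller cluster value. *)
pose F := within [set t | q t <= b - e] (0 : R)^'+.
have PF : ProperFilter F.
  split=> [FF0|]; last exact: within_filter.
  apply: nlow; move: FF0.
  rewrite /F /within/=; apply: filterS => t h; rewrite ltNge; apply/negP => h'.
  exact: (h h').
have rF : (0 : R)^'+ `<=` F by move=> V; rewrite /F/within/=; apply: filterS => t Vt _.
have [G' [c [PG' FG' c0 qc jc]]] := ray_cluster rF w1 a0 jb.
have cb : c <= b - e.
  apply: (cvgr_to_le qc); apply: FG'; rewrite /F/within/=.
  exact: filterE.
have := cluster_unique G PG b rG b0 qb c c0 jc.
by lra.
Qed.

End RayLimit.

Section RayDerivative.
Context {R : realType}.
Local Notation C := (Cplx R).
Local Notation C2 := (Cplx2 R).
Variables (phi : C2 -> C) (tau : C2) (M : R).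
Hypothesis hphi : schur2 phi.
Hypothesis ht : torus tau.
Hypothesis M0 : 0 < M.
Implicit Types (w : C) (t a : R).

Let K : R := Num.max 1 M.
Let k : R := Num.min 1 M.
Local Notation ray := (boundary_ray tau M).
Local Notation short_time := (short_time M).
Local Notation q := (ray_quotient phi tau M).

(** Put [z = (1 - conj w phi) / t].  Then [Re z >= q] because
   [|conj w phi| = |phi|], so [|z - q|^2 <= |z|^2 - q^2], and [ray_bound] bounds
   [|z|^2]. *)
Lemma ray_slope_bound w a t : circle w -> 0 <= a -> short_time t ->
  julia_bound phi tau w a (a / M) ->
  modulus ((1 - w^* * phi (ray t)) / t%:C - (q t)%:C) ^+ 2 <=
  2 * a / (2 - K * t) * q t - q t ^+ 2.
Proof.
move=> w1 a0 st jb; have [t0] := st; rewrite -/K => Kt.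
have [_ p1] := hphi (ray_bidisk ht M0 st).
have := ray_bound hphi ht M0 a0 st jb.
rewrite -(modulus_unit_den _ w1) -/K.
have mP : modulus (w^* * phi (ray t)) = modulus (phi (ray t)).
  by rewrite modulusM modulus_conj (w1 : modulus w = 1) mul1r.
have N0 := modulus_ge0 (phi (ray t)).
rewrite /ray_quotient.
move: (w^* * _) mP p1 N0 => P mP p1 N0.
set N := modulus (phi _) in mP p1 N0 *.
have -> : (1 - P) / t%:C - ((1 - N) / t)%:C = (1 - P - (1 - N)%:C) / t%:C :> C.
  by rewrite [RHS]mulrBl rmorphM fmorphV.
rewrite modulusM modulusV modulusC (gtr0_norm t0) exprMn exprVn => hP.
rewrite ler_pdivrMr ?exprn_gt0//.
have ReP : complex.Re P <= N by rewrite -mP (le_trans (ler_norm _))// normRe_modulus.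
have {hP} : modulus (1 - P - (1 - N)%:C) ^+ 2 <=
    (1 - N ^+ 2) * (a * (t / (2 - K * t))) - (1 - N) ^+ 2.
  apply: le_trans (lerB hP (lexx _)); rewrite !sqr_modulus.
  by case: (P) ReP => x y /=; rewrite subr0; nra.
move=> /le_trans; apply.
have Kt0 : 0 < 2 - K * t by lra.
have -> : (2 * a / (2 - K * t) * ((1 - N) / t) - ((1 - N) / t) ^+ 2) * t ^+ 2 =
   2 * (1 - N) * (a * (t / (2 - K * t))) - (1 - N) ^+ 2.
  by field; rewrite !gt_eqF.
rewrite lerD2r ler_wpM2r//; first by rewrite mulr_ge0// divr_ge0// ltW.
nra.
Qed.

(** As [q] tends to [a], the bound of [ray_slope_bound] tends to
   [a * a - a * a = 0]. *)
Lemma ray_derivative w a : circle w -> 0 <= a -> julia_bound phi tau w a (a / M) ->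
  q t @[t --> (0 : R)^'+] --> a ->
  is_directional_derivative phi tau w (tau.1, tau.2 * M%:C) (- (w * a%:C)).
Proof.
move=> w1 a0 jb qa.
pose z t : C := (1 - w^* * phi (ray t)) / t%:C.
have e0 : 2 * a / (2 - K * t) * q t - q t ^+ 2 @[t --> (0 : R)^'+] --> (0 : R).
  have c0 : 2 * a / (2 - K * t) @[t --> (0 : R)^'+] --> a by exact: cvg_ray_bound.
  have c1 : 2 * a / (2 - K * t) * q t @[t --> (0 : R)^'+] --> a * a by exact: (cvgM c0 qa).
  have c2 : q t ^+ 2 @[t --> (0 : R)^'+] --> a * a by exact: (cvgM qa qa).
  by rewrite -[X in _ --> X](subrr (a * a)); exact: (cvgB c1 c2).
have zq : (z t - (q t)%:C : C) @[t --> (0 : R)^'+] --> (0 : C).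
  apply/cvg_modulusP => e e1.
  have e2 : 0 < e ^+ 2 by rewrite exprn_gt0.
  have /cvgrPdist_lt/(_ _ e2) := e0.
  apply: filterS2 (near_short_time M) => t st.
  rewrite !sub0r normrN modulusN => h.
  rewrite -(ltr_pXn2r (ltn0Sn 1)) ?nnegrE ?modulus_ge0 ?(ltW e1)//.
  apply: le_lt_trans h; apply: le_trans (ler_norm _).
  exact: ray_slope_bound.
have qC : ((q t)%:C : C) @[t --> (0 : R)^'+] --> (a%:C : C).
  by apply/cvg_ReImP => /=; split=> //; exact: cvg_cst.
have za : z t @[t --> (0 : R)^'+] --> (a%:C : C).
  have h : (z t - (q t)%:C + (q t)%:C : C) @[t --> (0 : R)^'+] --> (0 + a%:C : C).
    exact: (cvgD zq qC).
  rewrite add0r in h; apply: cvg_trans h; apply: near_eq_cvg.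
  by apply: nearW => t; rewrite subrK.
have ww : w * w^* = 1.
  have := sqr_modulus w; rewrite (w1 : modulus w = 1) expr1n; case: (w) => x y /= h.
  by apply/eqP; rewrite eq_complex/=; apply/andP; split; apply/eqP; [rewrite h|]; ring.
have h : (- (w * z t) : C) @[t --> (0 : R)^'+] --> (- (w * a%:C) : C).
  exact: (cvgN (cvgMl_tmp za)).
rewrite /is_directional_derivative; apply: cvg_trans h; apply: near_eq_cvg.
apply: nearW => t.
by rewrite /z mulrA mulrBr mulrA ww mulr1 mul1r -mulNr opprB.
Qed.

End RayDerivative.

(** * The three conditions and the Julia inequality *)

Section Equivalences.
Context {R : realType}.
Local Notation C := (Cplx R).
Local Notation C2 := (Cplx2 R).
Variables (phi : C2 -> C) (tau : C2) (alpha M : R).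
Hypothesis hphi : schur2 phi.
Hypothesis ht : torus tau.
Hypothesis halpha : 0 < alpha.
Hypothesis M0 : 0 < M.
Implicit Types (w : C) (t a : R).

Let k : R := Num.min 1 M.
Local Notation ray := (boundary_ray tau M).
Local Notation short_time := (short_time M).
Local Notation q := (ray_quotient phi tau M).

Lemma julia_bound_le w (a1 a2 b1 b2 : R) : a1 <= b1 -> a2 <= b2 ->
  julia_bound phi tau w a1 a2 -> julia_bound phi tau w b1 b2.
Proof.
move=> ab1 ab2 jb mu mD; have [_ p1] := hphi mD; apply: (le_trans (jb mu mD)).
apply: ler_wpM2l; first by rewrite subr_ge0 expr_le1 ?modulus_ge0.
rewrite ge_max !le_max; apply/andP; split; apply/orP; [left|right];
  by rewrite ler_wpM2r// horocycle_level_ge0//; case: mD.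
Qed.

(** A finite lower limit means that the quotient is bounded on a trace of the
   neighbourhood filter of [tau]. *)
Lemma B_point_filter : B_point phi tau -> exists (F : set_system C2) (B : R),
  [/\ ProperFilter F, within (@bidisk R) (nbhs tau) `<=` F &
      \forall x \near F, julia_quotient phi x <= B].
Proof.
rewrite /B_point limf_einfE => h.
have [B hB] : exists B : R, (ereal_sup [set ereal_inf
    ((fun x => (julia_quotient phi x)%:E) @` V) | V in within (@bidisk R) (nbhs tau)] < B%:E)%E.
  move: h; case: ereal_sup => [r _|//|_]; last by exists 0; rewrite ltNyr.
  by exists (r + 1); rewrite lte_fin ltrDl.
pose F := within [set x | julia_quotient phi x <= B] (within (@bidisk R) (nbhs tau)).
exists F, B; split.
- split=> [F0|]; last exact: within_filter.
  pose V := [set x : C2 | ~ julia_quotient phi x <= B].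
  have VF : within (@bidisk R) (nbhs tau) V by exact: F0.
  have : (ereal_inf ((fun x => (julia_quotient phi x)%:E) @` V) < B%:E)%E.
    by apply: le_lt_trans hB; apply: ereal_sup_ubound; exists V.
  by move=> /ereal_inf_lt[_ [x Vx <-]]; rewrite lte_fin => /ltW /Vx.
- by move=> V; rewrite /F /within/=; apply: filterS => x Vx xD _; exact: Vx.
- by apply: withinT.
Qed.

Lemma within_cvg_fst (F : set_system C2) : within (@bidisk R) (nbhs tau) `<=` F ->
  x.1 @[x --> F] --> tau.1.
Proof.
move=> sF V V1; apply: sF.
have h : \forall x \near nbhs tau, V x.1 by exact: cvg_fst.
by apply: filterS h.
Qed.

Lemma within_cvg_snd (F : set_system C2) : within (@bidisk R) (nbhs tau) `<=` F ->
  x.2 @[x --> F] --> tau.2.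
Proof.
move=> sF V V1; apply: sF.
have h : \forall x \near nbhs tau, V x.2 by exact: cvg_snd.
by apply: filterS h.
Qed.

Lemma B_point_julia_bound : B_point phi tau ->
  exists (w : C) (a : R), [/\ circle w, 0 <= a & julia_bound phi tau w a (a / M)].
Proof.
move=> /B_point_filter[F [B [PF sF qB]]].
have xD : \forall x \near F, bidisk x by apply: sF; exact: withinT.
have [G [w [a1 [a2 [[PG FG w1] [a10 a20 _ _ jb]]]]]] :=
  julia_cluster hphi ht xD (within_cvg_fst sF) (within_cvg_snd sF) qB.
(* The two constants are enlarged so that their ratio becomes [M]. *)
exists w, (Num.max a1 (a2 * M)); split=> //; first by rewrite le_max a10.
apply: julia_bound_le jb; first by rewrite le_max lexx.
by rewrite ler_pdivlMr// le_max lexx orbT.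
Qed.

Lemma ray_quotient_cvg_B_point (b : R) : q t @[t --> (0 : R)^'+] --> b -> B_point phi tau.
Proof.
move=> qb; rewrite /B_point limf_einfE.
apply: (@le_lt_trans _ _ ((b + 1) / k)%:E); last exact: ltry.
apply: ge_ereal_sup => _ [V VF <-].
have h1 : \forall t \near (0 : R)^'+, V (ray t).
  have hV : \forall x \near nbhs tau, bidisk x -> V x by exact: VF.
  have := cvg_ray M ht hV; apply: filterS2 (near_short_time M) => t st; apply.
  exact: ray_bidisk.
have h2 : \forall t \near (0 : R)^'+, q t < b + 1.
  have /cvgrPdist_lt/(_ _ ltr01) := qb.
  by apply: filterS => t; rewrite ltr_norml => /andP[? _]; lra.
have [t [Vt [qt st]]] : exists t : R, V (ray t) /\ (q t < b + 1 /\ short_time t).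
  apply: (@filter_ex _ (0 : R)^'+); apply: filterI => //; apply: filterI => //.
  exact: near_short_time.
apply: ge_ereal_inf; exists (julia_quotient phi (ray t))%:E; first by exists (ray t).
rewrite lee_fin ray_julia_quotient// ler_pM2r ?invr_gt0 ?min1_gt0//.
exact: ltW.
Qed.

Lemma derivative_condition_julia_bound : derivative_condition phi tau alpha M ->
  exists2 w, circle w & julia_bound phi tau w alpha (alpha / M).
Proof.
move=> [/B_point_julia_bound[w [a [w1 a0 jb]]] [w' [d [bv dd da]]]].
have aM0 : 0 <= a / M by rewrite divr_ge0// ltW.
have ww : w' = w.
  exact: (boundary_value_unique ht M0 bv (julia_bound_boundary_value hphi a0 aM0 jb)).
rewrite {}ww in bv dd da.
have [b [b0 _ qb jb']] := ray_quotient_cvg hphi ht M0 w1 a0 jb.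
have db : d = - (w * b%:C).
  exact: (cvg_unique _ dd (ray_derivative hphi ht M0 w1 b0 jb' qb)).
have w0 : w != 0 by rewrite -modulus_eq0 (w1 : modulus w = 1) oner_eq0.
have bE : d / (- w) = b%:C by rewrite db invrN mulrNN mulrAC divff// mul1r.
exists w => //; apply: julia_bound_le jb'; rewrite bE lecR in da => //.
by rewrite ler_wpM2r// invr_ge0 ltW.
Qed.

Lemma julia_bound_derivative_condition w : circle w ->
  julia_bound phi tau w alpha (alpha / M) -> derivative_condition phi tau alpha M.
Proof.
move=> w1 jb; have aM0 : 0 <= alpha / M by rewrite divr_ge0// ltW.
have [b [b0 ba qb jb']] := ray_quotient_cvg hphi ht M0 w1 (ltW halpha) jb.
split; first exact: ray_quotient_cvg_B_point qb.
exists w, (- (w * b%:C)); split.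
- exact: (julia_bound_boundary_value hphi (ltW halpha) aM0 jb).
- exact: (ray_derivative hphi ht M0 w1 b0 jb' qb).
- have w0 : w != 0 by rewrite -modulus_eq0 (w1 : modulus w = 1) oner_eq0.
  by rewrite invrN mulrNN mulrAC divff// mul1r lecR.
Qed.

Lemma cvg_min T (F : set_system T) {FF : Filter F} (f g : T -> R) (a b : R) :
  f x @[x --> F] --> a -> g x @[x --> F] --> b ->
  Num.min (f x) (g x) @[x --> F] --> Num.min a b.
Proof.
have mE (x y : R) : Num.min x y = x + y - Num.max x y by have := addr_max_min x y; lra.
move=> fa gb; have h := cvg_max (FF := FF) fa gb.
rewrite mE; under eq_fun do rewrite mE.
exact: (cvgB (cvgD fa gb) h).
Qed.

(** Relates the two denominators [1 - maxmod] and [1 - |lambda_1|] through the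
   ratio whose limit is [M]. *)
Lemma maxmod_ratio (u : C2) : bidisk u ->
  (1 - maxmod u) / (1 - modulus u.1) =
  Num.min 1 ((1 - modulus u.2) / (1 - modulus u.1)).
Proof.
move=> [u1 u2]; have h : 0 < 1 - modulus u.1 by rewrite subr_gt0.
have -> : 1 - maxmod u = Num.min (1 - modulus u.1) (1 - modulus u.2).
  by rewrite /maxmod oppr_max addr_minr.
by rewrite minr_pMl ?invr_ge0 ?ltW// divff// gt_eqF.
Qed.

(** The limits [l * min(1, M)] and [l * min(1, M) / M] of the two ratios are at
   most [alpha] and [alpha / M]; this is where the case distinction on [M] comes
   from. *)
Lemma sequence_condition_julia_bound : sequence_condition phi tau alpha M ->
  exists2 w, circle w & julia_bound phi tau w alpha (alpha / M).
Proof.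
move=> [lam [lamD lamt ratio [l ql lle]]].
have l1 : (lam n).1 @[n --> \oo] --> tau.1 by exact: (cvg_comp _ _ lamt cvg_fst).
have l2 : (lam n).2 @[n --> \oo] --> tau.2 by exact: (cvg_comp _ _ lamt cvg_snd).
have qB : \forall n \near \oo, julia_quotient phi (lam n) <= l + 1.
  have /cvgrPdist_lt/(_ _ ltr01) := ql.
  by apply: filterS => n; rewrite ltr_norml => /andP[? _]; lra.
have xD : \forall n \near \oo, bidisk (lam n) by exact: nearW.
have [G [w [a1 [a2 [[PG FG w1] [a10 a20 k1 k2 jb]]]]]] :=
  julia_cluster hphi ht xD l1 l2 qB.
have FG' : Filter G by exact: _.
have ratioG : (1 - modulus (lam n).2) / (1 - modulus (lam n).1) @[n --> G] --> M.
  by move=> V /ratio; exact: FG.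
have qG : julia_quotient phi (lam n) @[n --> G] --> l by move=> V /ql; exact: FG.
have gap1 n : 1 - modulus (lam n).1 != 0.
  by have [h _] := lamD n; rewrite subr_eq0 eq_sym lt_eqF.
have gap2 n : 1 - modulus (lam n).2 != 0.
  by have [_ h] := lamD n; rewrite subr_eq0 eq_sym lt_eqF.
have gap n : 1 - maxmod (lam n) != 0.
  by have h := maxmod_lt1 (lamD n); rewrite subr_eq0 eq_sym lt_eqF.
have a1E : a1 = l * k.
  have h : Num.min 1 ((1 - modulus (lam n).2) / (1 - modulus (lam n).1)) @[n --> G] --> k.
    exact: (cvg_min (cvg_cst (1 : R)) ratioG).
  have h2 : julia_quotient phi (lam n) *
      Num.min 1 ((1 - modulus (lam n).2) / (1 - modulus (lam n).1)) @[n --> G] --> l * k.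
    exact: (cvgM qG h).
  have h3 : (1 - modulus (phi (lam n))) / (1 - modulus (lam n).1) @[n --> G] --> l * k.
    apply: cvg_trans h2; apply: near_eq_cvg; apply: nearW => n.
    by rewrite -maxmod_ratio// /julia_quotient mulrA divfK.
  exact: (cvg_unique _ k1 h3).
have a2E : a2 = a1 / M.
  have h : ((1 - modulus (lam n).2) / (1 - modulus (lam n).1))^-1 @[n --> G] --> M^-1.
    by apply: cvgV => //; rewrite gt_eqF.
  have h2 : (1 - modulus (phi (lam n))) / (1 - modulus (lam n).1) *
      ((1 - modulus (lam n).2) / (1 - modulus (lam n).1))^-1 @[n --> G] --> a1 / M.
    exact: (cvgM k1 h).
  have h3 : (1 - modulus (phi (lam n))) / (1 - modulus (lam n).2) @[n --> G] --> a1 / M.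
    apply: cvg_trans h2; apply: near_eq_cvg; apply: nearW => n.
    by field; rewrite gap1 gap2.
  exact: (cvg_unique _ k2 h3).
have a1le : a1 <= alpha.
  rewrite a1E /k; move: lle; case: (leP 1 M) => hM lle; first by rewrite mulr1.
  by rewrite -ler_pdivlMr.
exists w => //; apply: julia_bound_le jb => //.
by rewrite a2E ler_wpM2r// invr_ge0 ltW.
Qed.

(** Points of the ray form the sequence; there the ratio of the gaps is exactly
   [M]. *)
Lemma julia_bound_sequence_condition w : circle w ->
  julia_bound phi tau w alpha (alpha / M) -> sequence_condition phi tau alpha M.
Proof.
move=> w1 jb.
have [b [b0 ba qb jb']] := ray_quotient_cvg hphi ht M0 w1 (ltW halpha) jb.
pose K : R := Num.max 1 M.
have K0 : 0 < K := lt_le_trans ltr01 (ge1_max1 M).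
(* Dividing by [2 K] puts every term, the first included, in the range of
   [short_time]. *)
pose t (n : nat) : R := harmonic n / (K + K).
have t0 n : 0 < t n by rewrite divr_gt0// ?addr_gt0// invr_gt0.
have st n : short_time (t n).
  split=> //; rewrite -/K /t mulrCA.
  have KK : K + K != 0 by rewrite gt_eqF ?addr_gt0.
  have -> : K / (K + K) = 1 / 2 by apply: (mulIf KK); rewrite divfK//; lra.
  have : harmonic n <= 1 :> R by rewrite /harmonic/= invf_le1 ?ler1n ?ltr0n.
  lra.
have tr : t n @[n --> \oo] --> (0 : R)^'+.
  have t1 : t n @[n --> \oo] --> (0 : R).
    rewrite -[X in _ --> X](mul0r (K + K)^-1); apply: cvgMr_tmp.
    exact: cvg_harmonic.
  move=> V hV; have h : \forall s \near (0 : R), 0 < s -> V s by exact: hV.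
  have h2 : \forall n \near \oo, 0 < t n -> V (t n) by exact: (t1 _ h).
  by apply: filterS h2 => n h2; exact: (h2 (t0 n)).
exists (fun n => ray (t n)); split.
- by move=> n; exact: ray_bidisk.
- exact: (cvg_comp _ _ tr (cvg_ray M ht)).
- have -> : (fun n => (1 - modulus (ray (t n)).2) / (1 - modulus (ray (t n)).1)) = cst M.
    apply/funext => n; rewrite modulus_ray1// modulus_ray2// ![1 - (1 - _)]subKr.
    by rewrite mulrAC divff ?mul1r// gt_eqF.
  exact: cvg_cst.
- exists (b / k).
    have -> : (fun n => julia_quotient phi (ray (t n))) = (fun n => q (t n) / k).
      by apply/funext => n; rewrite ray_julia_quotient.
    by apply: cvgMr_tmp; exact: (cvg_comp _ _ tr qb).
  rewrite /k; case: (leP 1 M) => hM; first by rewrite divr1.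
  by rewrite ler_wpM2r// invr_ge0 ltW.
Qed.

(** If the inequality failed at [mu], then [V = |phi mu - w|^2 / (1 - |phi mu|^2)]
   would exceed the maximum, and [mu] would lie in the horosphere with radii
   [V / alpha] and [V M / alpha]; but [phi mu] is not in the horocycle of radius
   [V]. *)
Lemma horosphere_condition_julia_bound w :
  horosphere_condition phi tau alpha M w -> julia_bound phi tau w alpha (alpha / M).
Proof.
move=> [w1 hw] mu mD; have [m1 m2] := mD.
have L1 := horocycle_level_ge0 tau.1 m1; have L2 := horocycle_level_ge0 tau.2 m2.
have inball r1 r2 : horocycle_level mu.1 tau.1 < r1 -> horocycle_level mu.2 tau.2 < r2 ->
    horocycle w (Num.max (alpha * r1) (alpha * r2 / M)) (phi mu).
  move=> h1 h2; apply: (hw r1 r2 (le_lt_trans L1 h1) (le_lt_trans L2 h2)).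
  by exists mu => //; split; split.
have pD : disk (phi mu).
  by have [pD _] := inball _ _ (ltr_pwDr ltr01 (lexx _)) (ltr_pwDr ltr01 (lexx _)).
rewrite mulrC -ler_pdivrMr; last exact: one_sub_sqr_gt0.
rewrite leNgt; apply/negP.
set V := modulus (phi mu - w) ^+ 2 / _; rewrite gt_max => /andP[V1 V2].
have h1 : horocycle_level mu.1 tau.1 < V / alpha by rewrite ltr_pdivlMr// mulrC.
have h2 : horocycle_level mu.2 tau.2 < V * M / alpha.
  by rewrite ltr_pdivlMr// -ltr_pdivrMr// -mulrA mulrC.
have [_] := inball _ _ h1 h2.
have -> : alpha * (V / alpha) = V by field; rewrite gt_eqF.
have -> : alpha * (V * M / alpha) / M = V by field; rewrite !gt_eqF.
by rewrite -/V maxxx ltxx.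
Qed.

Lemma julia_bound_horosphere_condition w : ~ unimodular_constant phi -> circle w ->
  julia_bound phi tau w alpha (alpha / M) -> horosphere_condition phi tau alpha M w.
Proof.
move=> nc w1 jb; split=> // r1 r2 r10 r20 _ [mu [[m1 h1] [m2 h2]] <-].
have mD : bidisk mu by split.
have pD : disk (phi mu).
  have [_ p1] := hphi mD; rewrite /disk/= lt_neqAle p1 andbT; apply/negP => /eqP h.
  apply: nc; exists (phi mu) => // nu nD.
  exact: (schur_unimodular_constant hphi mD nD h).
split=> //; have := jb mu mD; rewrite mulrC -ler_pdivrMr; last exact: one_sub_sqr_gt0.
move=> /le_lt_trans; apply.
rewrite gt_max !lt_max; apply/andP; split; apply/orP; [left|right].
  by rewrite ltr_pM2l.
by rewrite mulrAC ltr_pM2r ?invr_gt0// ltr_pM2l.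
Qed.

End Equivalences.

Theorem theorem3p10 (R : realType) (phi : Cplx2 R -> Cplx R) (tau : Cplx2 R)
    (alpha M : R) (hphi : schur2 phi) (htau : torus tau)
    (halpha : 0 < alpha) (hM : 0 < M) :
  (derivative_condition phi tau alpha M <-> sequence_condition phi tau alpha M) /\
  (~ unimodular_constant phi ->
     (sequence_condition phi tau alpha M <->
      exists omega, horosphere_condition phi tau alpha M omega)) /\
  (forall omega, horosphere_condition phi tau alpha M omega ->
     is_boundary_value phi tau omega).
Proof.
split; first split.
- move=> /derivative_condition_julia_bound[]// w w1.
  exact: julia_bound_sequence_condition.
- move=> /sequence_condition_julia_bound[]// w w1.
  exact: julia_bound_derivative_condition.
split=> [nc|omega hw]; last first.
  apply: (@julia_bound_boundary_value _ _ _ _ alpha (alpha / M)) => //.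
  - exact: ltW.
  - by rewrite divr_ge0// ltW.
  - exact: horosphere_condition_julia_bound.
split=> [/sequence_condition_julia_bound[]// w w1 jb|[w hw]].
  by exists w; exact: julia_bound_horosphere_condition.
apply: (@julia_bound_sequence_condition _ _ _ _ _ _ _ _ _ w) => //; first by case: hw.
exact: horosphere_condition_julia_bound.
Qed.
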